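(* Let $T\in\{\mathbb{Z},\mathbb{R}\}$ and let $f$ be a Gaussian stationary process on $T$ with spectral measure $\rho$ satisfying the moment condition: there is $\delta>0$ with $\int_{T^*}|\lambda|^\delta\,d\rho(\lambda)<\infty$. Suppose there exist $a>0$ and $M,m>0$ such that for every interval $I\subset(-a,a)$, $$m|I|\le \rho(I)\le M|I|.$$ Then there exists $C=C(a,m,M)>0$ such that for all sufficiently large $N$, $$H_f(N)\le e^{-CN}.$$
   Context: A Gaussian process on $T$ ($T=\mathbb{Z}$ or $T=\mathbb{R}$) is a random function $f:T\to\mathbb{R}$ all of whose finite-dimensional marginals are multivariate Gaussian; processes on $\mathbb{R}$ are assumed continuous. It is stationary if its distribution is invariant under shifts by elements of $T$; here processes are centered. Its covariance function is $r(t)=\mathbb{E}[f(0)f(t)]$, and its spectral measure is the unique finite non-negative symmetric measure $\rho$ on $T^*$ with $r(t)=\int_{T^*}e^{-i\lambda t}\,d\rho(\lambda)$, where $\mathbb{Z}^*\simeq[-\pi,\pi]$ and $\mathbb{R}^*\simeq\mathbb{R}$. Every such measure determines a unique centered Gaussian stationary process. $|I|$ denotes the length of an interval $I$. The gap probability is $H_f(N)=\mathbb{P}(\forall t\in[0,N)\cap T:\ f(t)>0)$. *)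

(* Defs.v *)
From HB Require Import structures.
From mathcomp Require Import all_boot all_order all_algebra.
From mathcomp Require Import all_classical all_reals all_analysis.
Set Implicit Arguments. Unset Strict Implicit. Unset Printing Implicit Defensive.
Import Order.TTheory GRing.Theory Num.Theory.
Import numFieldNormedType.Exports.
Local Open Scope classical_set_scope.
Local Open Scope ring_scope.

Section defs.
Context {R : realType}.

Definition time_set (discrete : bool) : set R :=
  if discrete then [set x | exists k : int, x = k%:~R] else setT.

(* Spectral measures: finite, non-negative, symmetric Borel measures on T^*,
   where Z^* = [-pi, pi] (measure on R supported in [-pi,pi]) and R^* = R. *)
Definition spectral_measure (discrete : bool)
  (rho : {measure set R -> \bar R}) : Prop :=
  (rho setT < +oo)%E /\
  (forall A : set R, measurable A -> rho [set - x | x in A] = rho A) /\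
  (discrete -> rho (~` `[- pi, pi]) = 0%E).

(* Covariance function r(t) = int e^{-i lambda t} d rho(lambda); since rho is
   symmetric this is the real integral of cos(lambda t). *)
Definition covariance_of (rho : {measure set R -> \bar R}) (t : R) : R :=
  fine (\int[rho]_(l in setT) (cos (l * t))%:E)%E.

Definition centered_gaussian_law (v : R) : set R -> \bar R :=
  if v == 0 then \d_(0 : R) else normal_prob 0 (Num.sqrt v).

(* f is a centred Gaussian process on T with covariance E[f(s) f(t)] = r(t - s):
   every finite linear combination sum_i c_i f(t_i) (t_i in T) is a centred
   Gaussian random variable with variance sum_{i,j} c_i c_j r(t_j - t_i).
   Processes on R are assumed to have continuous sample paths. *)
Definition gaussian_process_with_covariance (discrete : bool)
  {d} {Omega : measurableType d} (P : probability Omega R)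
  (f : R -> Omega -> R) (r : R -> R) : Prop :=
  (forall (n : nat) (t : 'I_n -> R) (c : 'I_n -> R),
      (forall i, time_set discrete (t i)) ->
      let X := fun w => \sum_(i < n) c i * f (t i) w in
      measurable_fun setT X /\
      forall B : set R, measurable B ->
        P (X @^-1` B) =
        centered_gaussian_law (\sum_(i < n) \sum_(j < n) c i * c j * r (t j - t i)) B) /\
  (~~ discrete -> forall w, continuous (fun t => f t w)).

Definition gap_event (discrete : bool) {Omega : Type} (f : R -> Omega -> R) (N : R)
  : set Omega :=
  [set w | forall t, time_set discrete t -> 0 <= t -> t < N -> 0 < f t w].

(* Length of an interval; only used for bounded intervals. *)
Definition itv_length (i : interval R) : R :=
  match i with
  | Interval (BSide _ x) (BSide _ y) => Num.max 0 (y - x)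
  | _ => 0
  end.

End defs.

(* Main.v *)
Require Import Defs.
From HB Require Import structures.
From mathcomp Require Import all_boot all_order all_algebra.
From mathcomp Require Import all_classical all_reals all_analysis.
From mathcomp Require Import measurable_realfun zify ring lra.
Import Order.TTheory GRing.Theory Num.Theory.
Import numFieldNormedType.Exports.
Local Open Scope classical_set_scope.
Local Open Scope ring_scope.
Set Implicit Arguments.
Unset Strict Implicit.
Unset Printing Implicit Defensive.

(** Sample [f] along the [L] shifted lattices [u eta + s Z], [u < L], where
  [eta = s / L] and the spacing [s] is large compared to [1 / a], taking [n]
  points on each lattice.
  The full average [Y] of the [n L] samples has variance [O(1/n)], because the
  spectral mass near the origin is controlled by the upper bound [M]; hence
  [Y > K] has probability [exp(-c n)].  In the continuous case the Dirichlet
  kernel of the grid has further peaks at the multiples of [2 pi / eta]; they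
  are harmless once [eta] is so small (depending on [n]) that [rho] has mass
  [O(1/n^2)] there.
  On the gap event with [Y <= K], put [h x = (2 + cos x) / 3].  Since
  [h x >= exp(-x)] for [x >= 0], Jensen's inequality gives
  [avg_u prod_j h(f(u eta + j s)) >= exp(-n K)].  On the other hand [h] is a
  positive combination of cosines and, since [s > pi / a], the lower bound [m]
  makes the covariance of the samples along a lattice at least [(2 pi m / s) Id];
  therefore [E prod_j h(f(u eta + j s)) <= r^n] with
  [r = (2 + exp(- pi m / s)) / 3 < 1], and one takes [K = - ln r / 2]. *)

(** * Gaussian laws *)

Lemma bounded_integrable d (T : measurableType d) (R : realType)
    (mu : {measure set T -> \bar R}) (A : set T) (f : T -> R) (B : R) :
  measurable A -> (mu A < +oo)%E -> measurable_fun A f ->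
  (forall x, A x -> `|f x| <= B) -> mu.-integrable A (EFin \o f).
Proof.
move=> mA Afin mf fB; apply: measurable_bounded_integrable => //.
exists B; split; first exact: num_real.
by move=> x Bx y Ay /=; apply: le_trans (ltW Bx); exact: fB.
Qed.

Lemma is_derive_normal_pdf (R : realType) (s x : R) : s != 0 ->
  is_derive x 1 (normal_pdf 0 s) (- (x / s ^+ 2) * normal_pdf 0 s x).
Proof.
move=> s0; rewrite normal_pdfE//.
rewrite /normal_fun.
have -> : (fun x => normal_peak s * expR (- (x - 0) ^+ 2 / (s ^+ 2 *+ 2))) =
  (fun x => normal_peak s * (expR \o (fun x => - (s ^+ 2 *+ 2)^-1 * (x ^+ 2))) x).
  by apply/funext => y /=; rewrite subr0 !mulNr [X in expR (- X)]mulrC.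
apply: is_derive_eq.
rewrite /= /GRing.scale/= subr0.
have -> : - x ^+ 2 / (s ^+ 2 *+ 2) = - (s ^+ 2 *+ 2)^-1 * x ^+ 2.
  by rewrite !mulNr mulrC.
by set E := expR _; field.
Qed.

(* [f t x] is chosen so that its [t]-derivative [h t x] is also the [x]-derivative
  of [g t x]: the integral of [f t] over [-A, A] then varies in [t] only through
  boundary terms, which vanish as A tends to infinity. *)
Section normal_charfun.
Variables (R : realType) (s : R).
Hypothesis s0 : s != 0.
Local Notation mu := lebesgue_measure.
Local Notation p := (normal_pdf 0 s).

Let f (t x : R) : R := expR (s ^+ 2 * t ^+ 2 / 2) * cos (t * x) * p x.

Let h (t x : R) : R := expR (s ^+ 2 * t ^+ 2 / 2) *
  (s ^+ 2 * t * cos (t * x) - x * sin (t * x)) * p x.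

Let g (t x : R) : R := s ^+ 2 * expR (s ^+ 2 * t ^+ 2 / 2) * sin (t * x) * p x.

Let derf (t x : R) : is_derive t 1 (f ^~ x) (h t x).
Proof.
have -> : f ^~ x = (fun t => (expR \o (fun t => (s ^+ 2 / 2) * t ^+ 2)) t
   * (cos \o (fun t => x * t)) t * p x).
  by apply/funext => u; rewrite /f /= (mulrC u x) (mulrAC (s ^+ 2)).
apply: is_derive_eq.
rewrite /= /GRing.scale/= /h (mulrC t x) (mulrAC (s ^+ 2)).
by field.
Qed.

Let derg (t x : R) : is_derive x 1 (g t) (h t x).
Proof.
have dp := is_derive_normal_pdf x s0.
have -> : g t = (fun x => s ^+ 2 * expR (s ^+ 2 * t ^+ 2 / 2) *
   ((sin \o (fun x => t * x)) x * p x)).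
  by apply/funext => u; rewrite /g /= !mulrA.
apply: is_derive_eq.
rewrite /= /GRing.scale/= /h.
by field.
Qed.

Let cont_deriv (k k' : R -> R) : (forall x : R, is_derive x 1 k (k' x)) -> continuous k.
Proof. by move=> dk x; apply/differentiable_continuous/derivable1_diffP; have [] := dk x. Qed.

Let cf t : continuous (f t).
Proof.
have dp x := is_derive_normal_pdf x s0.
move=> x; apply: cvgM; last exact: (cont_deriv dp).
apply: cvgM; first exact: cvg_cst.
apply: continuous_comp; last exact: continuous_cos.
by apply: cvgM; [exact: cvg_cst|exact: cvg_id].
Qed.

Let ch t : continuous (h t).
Proof.
have dp x := is_derive_normal_pdf x s0.
have ctx x : {for x, continuous (fun x : R => t * x)}.
  by apply: cvgM; [exact: cvg_cst|exact: cvg_id].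
move=> x; apply: cvgM; last exact: (cont_deriv dp).
apply: cvgM; first exact: cvg_cst.
apply: cvgB.
  apply: cvgM; first exact: cvg_cst.
  by apply: continuous_comp; [exact: ctx|exact: continuous_cos].
apply: cvgM; first exact: cvg_id.
by apply: continuous_comp; [exact: ctx|exact: continuous_sin].
Qed.

Let mf t : measurable_fun setT (f t).
Proof. by apply: continuous_measurable_fun; exact: cf. Qed.

Let p_le x : `|p x| <= normal_peak s.
Proof. by rewrite ger0_norm ?normal_pdf_ge0// normal_pdf_ub. Qed.

Let F A t := \int[mu]_(x in `[- A, A]) f t x.

Let itvfin (A : R) : (mu `[(- A)%R, A]%classic < +oo)%E.
Proof. by rewrite lebesgue_measure_itv/=; case: ifP => // _; rewrite -EFinB ltry. Qed.

Let intf A t : mu.-integrable `[- A, A] (EFin \o f t).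
Proof.
apply: (@bounded_integrable _ _ _ _ _ _ (expR (s ^+ 2 * t ^+ 2 / 2) * normal_peak s)) => //.
- exact: itvfin.
- exact: (measurable_funTS (mf t)).
- move=> x _; rewrite /f 2!normrM ler_pM//.
  by rewrite ger0_norm ?expR_ge0// ler_piMr ?expR_ge0// cos_max.
Qed.

Let intfh A t : 0 < A -> \int[mu]_(x in `[- A, A]) h t x = g t A - g t (- A).
Proof.
move=> A0; rewrite /Rintegral (@continuous_FTC2 _ _ (g t))//.
- by rewrite gtrN.
- by apply: continuous_subspaceT; exact: ch.
- have cg := cont_deriv (derg t).
  split; first by move=> x _; have [] := derg t x.
  + exact/cvg_at_right_filter/cg.
  + exact/cvg_at_left_filter/cg.
- by move=> x _; rewrite derive1E; apply: derive_val.
Qed.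

Let derF (A t : R) : 0 < A -> is_derive t 1 (F A) (g t A - g t (- A)).
Proof.
move=> A0; rewrite -intfh//.
pose T := `|t| + 1.
have tT : `](- T), T[%classic t.
  by rewrite /= in_itv/= -ltr_norml /T ltrDl.
(* This constant dominates [|h t x|] for [|t| < T] and [|x| <= A], since sine and cosine are at most
   1 in absolute value and the density is at most its peak. *)
pose G (_ : R) := expR (s ^+ 2 * T ^+ 2 / 2) * (s ^+ 2 * T + A) * normal_peak s.
have T0 : 0 <= T by rewrite addr_ge0.
have dfh x y : partial1of2 f x y = h x y.
  by rewrite /partial1of2 derive1E; apply: derive_val.
have G0 y : 0 <= G y.
  rewrite /G mulr_ge0 ?normal_peak_ge0// mulr_ge0 ?expR_ge0//.
  by apply: addr_ge0; [rewrite mulr_ge0// sqr_ge0|exact: ltW].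
have intG : mu.-integrable `[- A, A] (EFin \o G).
  apply: (@bounded_integrable _ _ _ _ _ _ (G 0)) => //.
  - exact: itvfin.
  - exact: measurable_cst.
  - by move=> x _; rewrite ger0_norm//; exact: G0.
have hG x y : `](- T), T[%classic x -> `[- A, A]%classic y ->
    `|partial1of2 f x y| <= G y.
  rewrite /= in_itv/= in_itv/= -ltr_norml -ler_norml => xT yA.
  rewrite dfh /h /G 2!normrM ler_pM// ler_pM//.
    rewrite ger0_norm ?expR_ge0// ler_expR ler_pM2r// ler_wpM2l ?sqr_ge0//.
    by rewrite -(real_normK (num_real x)) lerXn2r ?nnegrE// ltW.
  rewrite (le_trans (ler_normB _ _))// lerD//.
    rewrite 2!normrM [`|s ^+ 2|]ger0_norm ?sqr_ge0//.
    rewrite -[leRHS]mulr1 ler_pM ?cos_max//; first by rewrite mulr_ge0 ?sqr_ge0.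
    by apply: ler_wpM2l; [exact: sqr_ge0|exact: ltW].
  by rewrite normrM -[leRHS]mulr1 ler_pM ?sin_max.
have ef : forall x y, `](- T), T[%classic x -> `[- A, A]%classic y ->
  derivable (f ^~ y) x 1 by move=> x y _ _; have [] := derf x y.
have ei : forall x, `](- T), T[%classic x -> mu.-integrable `[- A, A] (EFin \o f x).
  by move=> x _; exact: intf.
apply: DeriveDef.
  have H := @derivable_under_integral R _ (measurableTypeR R) mu f _ (measurable_itv _) t (- T) T tT ei ef G G0 intG hG.
  exact: H.
rewrite -derive1E.
have H := @differentiation_under_integral R _ (measurableTypeR R) mu f _ (measurable_itv _) t (- T) T tT ei ef G G0 intG hG.
rewrite [LHS]H.
by apply: eq_Rintegral => x _; exact: dfh.
Qed.

Let FB A : 0 < A -> `|F A 1 - F A 0| <=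
  (s ^+ 2 * expR (s ^+ 2 / 2)) * (p A + p (- A)).
Proof.
move=> A0.
have cF : {within `[0, 1], continuous (F A)}.
  apply: continuous_subspaceT; apply: (@cont_deriv _ (fun t => g t A - g t (- A))).
  by move=> x; exact: derF.
have [c] := MVT ltr01 (fun x _ => derF x A0) cF.
rewrite in_itv/= subr0 mulr1 => /andP[c0 c1] ->.
have gB y : `|g c y| <= (s ^+ 2 * expR (s ^+ 2 / 2)) * p y.
  rewrite /g 3!normrM [`|p y|]ger0_norm ?normal_pdf_ge0// ler_wpM2r ?normal_pdf_ge0//.
  rewrite [`|s ^+ 2|]ger0_norm ?sqr_ge0// -[leRHS]mulr1 ler_pM ?sin_max//.
    by rewrite mulr_ge0 ?sqr_ge0.
  rewrite ler_wpM2l ?sqr_ge0// ger0_norm ?expR_ge0// ler_expR ler_pM2r//.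
  by rewrite ler_piMr ?sqr_ge0// expr_le1 ?ltW.
by rewrite mulrDr (le_trans (ler_normB _ _))// lerD.
Qed.

Let cvgF t : F n.+1%:R t @[n --> \oo] --> \int[mu]_x f t x.
Proof.
pose fn (n : nat) (x : R) := ((f t) \_ `[- n.+1%:R, n.+1%:R]) x.
have intp : mu.-integrable setT (fun x => (expR (s ^+ 2 * t ^+ 2 / 2))%:E * (p x)%:E)%E.
  by apply: integrableZl => //; exact: integrable_normal_pdf.
have fB x : `|f t x| <= expR (s ^+ 2 * t ^+ 2 / 2) * p x.
  rewrite /f 2!normrM [`|p x|]ger0_norm ?normal_pdf_ge0// ler_wpM2r ?normal_pdf_ge0//.
  by rewrite ger0_norm ?expR_ge0// ler_piMr ?expR_ge0// cos_max.
have mfn n : measurable_fun setT (EFin \o fn n).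
  apply/measurable_EFinP/measurable_restrict => //.
  exact: measurable_funS (mf t).
have fnf : {ae mu, forall x, setT x -> (EFin \o fn n) x @[n --> \oo] --> (EFin \o f t) x}.
  apply: aeW => x _; apply: cvg_near_cst.
  near=> n; rewrite /= /fn patchE mem_set//= in_itv/= -ler_norml.
  by near: n; apply: filterS (nbhs_infty_ger `|x|) => n /le_trans; apply; rewrite ler_nat.
have fng : {ae mu, forall x n, setT x -> (`|(EFin \o fn n) x| <=
    (expR (s ^+ 2 * t ^+ 2 / 2))%:E * (p x)%:E)%E}.
  apply: aeW => x n _; rewrite /= lee_fin /fn patchE; case: ifP => _; first exact: fB.
  by rewrite normr0 (le_trans _ (fB x)).
have [_ _] := @dominated_convergence _ (measurableTypeR R) R mu setT measurableT (fun n => EFin \o fn n) (EFin \o f t) _ mfn ((measurable_EFinP _ _).2 (mf t)) fnf intp fng.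
have ift : mu.-integrable setT (EFin \o f t).
  apply: le_integrable intp => //; first exact: ((measurable_EFinP _ _).2 (mf t)).
  by move=> x _; rewrite lee_fin (le_trans (fB x))// ler_norm.
move=> cvgfn.
have -> : (fun n : nat => F n.+1%:R t) = fine \o (fun n => \int[mu]_x (EFin \o fn n) x)%E.
  by apply/funext => n; rewrite /F Rintegral_mkcond.
apply: fine_cvg; rewrite fineK//.
exact: integrable_fin_num.
Unshelve. all: by end_near. Qed.

Let p_cvg0 : (s ^+ 2 * expR (s ^+ 2 / 2)) * (p n.+1%:R + p (- n.+1%:R))
  @[n --> \oo] --> (0 : R).
Proof.
(* The crude bound [exp y >= 1 + y] already gives decay of order [1 / (n + 1)], which suffices. *)
have pB (n : nat) : p n.+1%:R <= normal_peak s * (s ^+ 2 *+ 2) * harmonic n.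
  rewrite normal_pdfE// -mulrA ler_wpM2l ?normal_peak_ge0// /normal_fun subr0.
  rewrite mulNr expRN /harmonic /= -[leRHS]invrK lef_pV2 ?posrE ?expR_gt0 ?invr_gt0//; last first.
    by rewrite mulr_gt0// pmulrn_lgt0// exprn_even_gt0.
  apply: le_trans (expR_ge1Dx _).
  rewrite invfM invrK mulrC -[leLHS]add0r lerD//.
  by rewrite ler_wpM2r ?invr_ge0 ?mulrn_wge0 ?sqr_ge0// expr2 ler_peMl// ler1n.
have pN (n : nat) : p (- n.+1%:R) = p n.+1%:R.
  by rewrite normal_pdfE// /normal_fun !subr0 sqrrN.
rewrite -[X in _ --> X](mulr0 (s ^+ 2 * expR (s ^+ 2 / 2))); apply: cvgMl_tmp.
rewrite [X in X @ _](_ : _ = (fun n : nat => p n.+1%:R * 2)); last first.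
  by apply/funext => n; rewrite pN -mulr2n mulr_natr.
rewrite -[X in _ --> X](mul0r 2); apply: cvgMr_tmp.
apply: (@squeeze_cvgr _ _ _ _ (cst 0) (fun n => normal_peak s * (s ^+ 2 *+ 2) * harmonic n)).
- by apply: nearW => n; rewrite normal_pdf_ge0 pB.
- exact: cvg_cst.
- by rewrite -[X in _ --> X](mulr0 (normal_peak s * (s ^+ 2 *+ 2))); apply: cvgMl_tmp; exact: cvg_harmonic.
Qed.

(** The integral of [f t] over the line is the same at [t = 0] and at [t = 1]: at 0 it is the total
    mass 1, at 1 it is [exp(s^2 / 2)] times the integral sought. *)
Lemma integral_cos_normal_pdf :
  \int[mu]_x (cos x * p x) = expR (- (s ^+ 2 / 2)).
Proof.
have cp : mu.-integrable setT (EFin \o (fun x => cos x * p x)).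
  apply: le_integrable (integrable_normal_pdf 0 s) => //.
    apply/measurable_EFinP/measurable_funM; last exact: measurable_normal_pdf.
    by apply: continuous_measurable_fun; exact: continuous_cos.
  by move=> x _; rewrite lee_fin normrM ler_piMl// cos_max.
have : F n.+1%:R 1 - F n.+1%:R 0 @[n --> \oo] --> (0 : R).
  apply: norm_cvg0; apply: squeeze_cvgr (cvg_cst 0) p_cvg0.
  by apply: nearW => n; rewrite normr_ge0 FB.
move=> /(cvg_unique (@Rhausdorff _) (cvgB (@cvgF 1) (@cvgF 0))) /eqP.
rewrite subr_eq0 => /eqP.
have -> : \int[mu]_x f 0 x = 1.
  rewrite (_ : 1 = fine 1%:E)// -(integral_normal_pdf 0 s).
  by apply: eq_Rintegral => x _; rewrite /f expr0n mulr0 mul0r mul0r expR0 cos0 !mul1r.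
have -> : \int[mu]_x f 1 x = \int[mu]_x (expR (s ^+ 2 / 2) * (cos x * p x)).
  by apply: eq_Rintegral => x _; rewrite /f expr1n mulr1 mul1r mulrA.
rewrite RintegralZl// => /(congr1 (fun y => expR (- (s ^+ 2 / 2)) * y)).
by rewrite mulrA -expRD addNr expR0 mul1r mulr1.
Qed.

End normal_charfun.

(** The Radon-Nikodym derivative of [normal_prob] and [normal_pdf] have the same integral over every
    measurable set, so they agree almost everywhere. *)
Lemma integral_normal_prob (R : realType) (m s B : R) (g : R -> R) :
  measurable_fun setT g -> (forall x, `|g x| <= B) ->
  (\int[normal_prob m s]_x (g x)%:E =
   \int[lebesgue_measure]_x (g x * normal_pdf m s x)%:E)%E.
Proof.
move=> mg gB.
have dom := normal_prob_dominates m s.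
have mpdf := measurable_normal_pdf m s.
have ig : (normal_prob m s).-integrable setT (EFin \o g).
  apply: (@bounded_integrable _ _ _ _ _ _ B) => //.
  by rewrite ltey_eq fin_num_measure.
rewrite -(Radon_Nikodym_change_of_variables dom)//.
under [RHS]eq_integral do rewrite EFinM.
apply: ae_eq_integral => //.
- apply: emeasurable_funM; first exact/measurable_EFinP.
  apply: (measurable_int lebesgue_measure).
  exact: Radon_Nikodym_integrable.
- by apply: emeasurable_funM; exact/measurable_EFinP.
- apply: ae_eqe_mul2l => /=.
  rewrite Radon_NikodymE//=.
  case: cid => /= h [h1 h2 h3].
  apply: integral_ae_eq => //=.
  + exact/measurable_EFinP.
  + by move=> E _ mE; rewrite -h3.
Qed.

(** Half of the exponent is spent on the bound: for [x > K], [exp(-x^2 / (2 s^2)) <= exp(-K^2 / (4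
    s^2)) exp(-x^2 / (4 s^2))]. Up to normalisation the last factor is the normal density of
    standard deviation [sqrt 2 * s], whose mass is 1. *)
Lemma normal_prob_tail (R : realType) (s K : R) : 0 < s -> 0 <= K ->
  (normal_prob 0 s `]K, +oo[%classic <=
   (Num.sqrt 2 * expR (- (K ^+ 2 / (4 * s ^+ 2))))%:E)%E.
Proof.
move=> s0 K0.
have sn0 : s != 0 by rewrite gt_eqF.
have r2 : 0 < Num.sqrt 2 :> R by rewrite sqrtr_gt0.
set s' := Num.sqrt 2 * s.
have s'0 : 0 < s' by rewrite mulr_gt0.
have s'n0 : s' != 0 by rewrite gt_eqF.
have s's : s' ^+ 2 = s ^+ 2 *+ 2 by rewrite exprMn sqr_sqrtr// mulr_natl.
have pk : normal_peak s = Num.sqrt 2 * normal_peak s'.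
  have -> : normal_peak s' = (Num.sqrt 2 * Num.sqrt (s ^+ 2 * pi *+ 2))^-1.
    by rewrite /normal_peak s's -sqrtrM//; congr (Num.sqrt _)^-1; ring.
  by rewrite invfM mulVKf ?gt_eqF.
have le x : `]K, +oo[%classic x -> normal_pdf 0 s x <=
    Num.sqrt 2 * expR (- (K ^+ 2 / (4 * s ^+ 2))) * normal_pdf 0 s' x.
  rewrite /= in_itv/= andbT => Kx.
  rewrite !normal_pdfE// pk -!mulrA ler_wpM2l ?sqrtr_ge0//.
  rewrite [leRHS]mulrCA ler_wpM2l ?normal_peak_ge0//.
  rewrite /normal_fun !subr0 -expRD ler_expR s's.
  have x2 : K ^+ 2 <= x ^+ 2 by rewrite lerXn2r ?nnegrE// ltW// (le_lt_trans K0).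
  rewrite -subr_ge0 (_ : _ - _ = (x ^+ 2 - K ^+ 2) / (4 * s ^+ 2)); last by field.
  by rewrite divr_ge0 ?subr_ge0// mulr_ge0// sqr_ge0.
rewrite /normal_prob.
apply: (@le_trans _ _ (\int[lebesgue_measure]_(x in `]K, +oo[)
   (Num.sqrt 2 * expR (- (K ^+ 2 / (4 * s ^+ 2))) * normal_pdf 0 s' x)%:E)%E).
  apply: ge0_le_integral => //=.
  - by move=> x _; rewrite lee_fin normal_pdf_ge0.
  - by apply/measurable_EFinP; apply: measurable_funTS; exact: measurable_normal_pdf.
  - apply/measurable_EFinP; apply: measurable_funTS; apply: measurable_funM => //.
    exact: measurable_normal_pdf.
under eq_integral do rewrite EFinM.
rewrite ge0_integralZl//=.
- rewrite -[leRHS]mule1 lee_wpmul2l//.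
  have := @probability_le1 _ _ _ (normal_prob 0 s') `]K, +oo[%classic.
  by apply.
- by apply/measurable_EFinP; apply: measurable_funTS; exact: measurable_normal_pdf.
- by move=> x _; rewrite lee_fin normal_pdf_ge0.
Qed.

Section centered_gaussian.
Context d (Omega : measurableType d) (R : realType) (P : probability Omega R).
Variables (X : Omega -> R) (v : R).
Hypothesis v0 : 0 <= v.
Hypothesis mX : measurable_fun setT X.
Hypothesis lawX : forall B : set R, measurable B ->
  P (X @^-1` B) = centered_gaussian_law v B.

Lemma expectation_cos_gaussian : \int[P]_w cos (X w) = expR (- (v / 2)).
Proof.
pose Y : Omega -> measurableTypeR R := X.
have mY : measurable_fun setT Y := mX.
have mcos : measurable_fun [set: measurableTypeR R] (@cos R).
  have : measurable_fun [set: R] (@cos R).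
    by apply: continuous_measurable_fun; exact: continuous_cos.
  by [].
rewrite (_ : \int[P]_w cos (X w) = \int[pushforward P Y]_x cos x); last first.
  congr fine; rewrite integral_pushforward//=; first exact/measurable_EFinP.
  rewrite preimage_setT.
  apply: (@bounded_integrable _ _ _ _ _ _ 1) => //.
  - by rewrite ltey_eq fin_num_measure.
  - exact: measurableT_comp.
  - by move=> x _ /=; exact: cos_max.
have [v00|vn0] := eqVneq v 0.
  rewrite v00 mul0r oppr0 expR0 /Rintegral.
  rewrite (@eq_measure_integral _ _ _ setT (\d_(0 : measurableTypeR R))); last first.
    by move=> A mA _; have := lawX mA; rewrite /centered_gaussian_law v00 eqxx.
  rewrite integral_dirac//; last exact/measurable_EFinP.
  by rewrite diracT mul1e /= cos0.
have sv : 0 < Num.sqrt v by rewrite sqrtr_gt0 lt_neqAle eq_sym vn0.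
transitivity (\int[normal_prob 0 (Num.sqrt v)]_x cos x).
  have H (A : set (measurableTypeR R)) : measurable A -> A `<=` setT ->
      pushforward P Y A = normal_prob 0 (Num.sqrt v) A.
    by move=> mA _; have := lawX mA; rewrite /centered_gaussian_law (negbTE vn0).
  congr fine.
  exact: (@eq_measure_integral _ (measurableTypeR R) R setT _ _ (EFin \o cos) H).
rewrite /Rintegral (@integral_normal_prob _ _ _ 1)//; last exact: cos_max.
have := @integral_cos_normal_pdf R (Num.sqrt v).
by rewrite gt_eqF// sqr_sqrtr// => /(_ isT).
Qed.

Lemma gaussian_tail (V K : R) : v <= V -> 0 < V -> 0 <= K ->
  (P [set w | K < X w]%R <= (Num.sqrt 2 * expR (- (K ^+ 2 / (4 * V))))%:E)%E.
Proof.
move=> vV V0 K0.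
have -> : [set w | K < X w] = X @^-1` `]K, +oo[%classic.
  by apply/seteqP; split => w /=; rewrite in_itv/= andbT.
rewrite lawX// /centered_gaussian_law; case: ifPn => [_|vn0].
  rewrite diracE memNset ?lee_fin ?mulr_ge0 ?sqrtr_ge0 ?expR_ge0//=.
  by rewrite in_itv/= andbT; apply/negP; rewrite -leNgt.
have vp : 0 < v by rewrite lt_neqAle eq_sym vn0.
apply: le_trans (normal_prob_tail _ K0) _; first by rewrite sqrtr_gt0.
rewrite lee_fin ler_wpM2l ?sqrtr_ge0// ler_expR lerN2 sqr_sqrtr//.
by rewrite ler_wpM2l ?sqr_ge0// lef_pV2 ?posrE ?mulr_gt0// ler_pM2l.
Qed.

End centered_gaussian.

(** * Trigonometric sums and spectral forms *)

Lemma integrable_sum_EFin d (T : measurableType d) (R : realType)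
    (mu : {measure set T -> \bar R}) (A : set T) (I : Type) (s : seq I)
    (f : I -> T -> R) : measurable A ->
  (forall i, mu.-integrable A (EFin \o f i)) ->
  mu.-integrable A (EFin \o (fun x => \sum_(i <- s) f i x)).
Proof.
move=> mA intf.
have -> : EFin \o (fun x => \sum_(i <- s) f i x) =
    (fun x => \sum_(i <- s) (f i x)%:E)%E.
  by apply/funext => x /=; rewrite sumEFin.
by apply: integrable_sum => // i _; exact: intf.
Qed.

Lemma Rintegral_sum d (T : measurableType d) (R : realType)
    (mu : {measure set T -> \bar R}) (A : set T) (I : Type) (s : seq I)
    (f : I -> T -> R) : measurable A ->
  (forall i, mu.-integrable A (EFin \o f i)) ->
  \int[mu]_(x in A) (\sum_(i <- s) f i x) = \sum_(i <- s) \int[mu]_(x in A) f i x.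
Proof.
move=> mA intf; elim: s => [|i s ih].
  under eq_Rintegral do rewrite big_nil.
  by rewrite Rintegral_cst// mul0r big_nil.
under eq_Rintegral do rewrite big_cons.
rewrite RintegralD//; last exact: integrable_sum_EFin.
by rewrite big_cons ih.
Qed.

Lemma integrableZl_EFin d (T : measurableType d) (R : realType)
    (mu : {measure set T -> \bar R}) (A : set T) (f : T -> R) (k : R) :
  measurable A -> mu.-integrable A (EFin \o f) ->
  mu.-integrable A (EFin \o (fun x => k * f x)).
Proof.
move=> mA intf.
have -> : EFin \o (fun x => k * f x) = (fun x => k%:E * (f x)%:E)%E by apply/funext.
exact: integrableZl.
Qed.

Section trigonometric_sums.
Variable R : realType.
Implicit Types x y theta : R.

Lemma cos_lipschitz x y : `|cos x - cos y| <= `|x - y|.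
Proof.
wlog xy : x y / y <= x.
  move=> wl; case: (leP y x) => [|/ltW] h; first exact: wl.
  by rewrite distrC (distrC x); exact: wl.
have [|c _ ->] := @MVT_segment R cos (fun x => - sin x) y x xy.
- by apply: continuous_subspaceT; exact: continuous_cos.
- by rewrite normrM normrN ler_piMl// sin_max.
Qed.

(** With [y = x + k theta], each term is [2 sin(theta/2) cos y = sin(y + theta/2) - sin(y -
    theta/2)]. *)
Lemma sum_cos_telescope x theta n :
  2 * sin (theta / 2) * (\sum_(k < n) cos (x + k%:R * theta)) =
  sin (x + n%:R * theta - theta / 2) - sin (x - theta / 2).
Proof.
elim: n => [|n ih]; first by rewrite big_ord0 mulr0 mul0r addr0 subrr.
rewrite big_ord_recr/= mulrDr ih.
have -> : x + n.+1%:R * theta - theta / 2 = (x + n%:R * theta) + theta / 2.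
  by rewrite -natr1; field.
by rewrite (sinD (x + _) (theta / 2)) (sinB (x + _) (theta / 2)); ring.
Qed.

(** Kept as a product, so that it also makes sense where [sin(theta/2)] vanishes; the free phase [x]
    lets sine sums be treated as cosine sums. *)
Lemma sum_cos_sin_le1 x theta n :
  `|sin (theta / 2) * \sum_(k < n) cos (x + k%:R * theta)| <= 1.
Proof.
rewrite -(ler_pM2l (ltr0n _ 2)) mulr1 -[X in X * _]normr_nat -normrM mulrA.
rewrite sum_cos_telescope (le_trans (ler_normB _ _))//.
by rewrite -[leRHS]/(1 + 1) lerD// sin_max.
Qed.

Lemma sinD2pin x n : sin (x + n%:R * (pi *+ 2)) = sin x.
Proof.
elim: n x => [|n ih] x; first by rewrite mul0r addr0.
by rewrite -natr1 mulrDl mul1r addrA sinD2pi ih.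
Qed.

(** A sum over powers of an [L]-th root of unity other than 1: [sin(theta/2) = sin(pi p / L)] is
    nonzero, and the arguments of the two telescoped sines differ by [p] full periods. *)
Lemma sum_cos_eq0 x (L p : nat) : (0 < p < L)%N ->
  \sum_(k < L) cos (x + k%:R * (pi *+ 2 * (p%:R / L%:R))) = 0.
Proof.
move=> /andP[p0 pL].
have L0n : (0 < L)%N by exact: ltn_trans pL.
have L0 : 0 < L%:R :> R by rewrite ltr0n.
set theta := pi *+ 2 * (p%:R / L%:R).
have s0 : sin (theta / 2) != 0.
  rewrite gt_eqF// sin_gt0_pi//.
  have -> : theta / 2 = pi * (p%:R / L%:R) by rewrite /theta; field; rewrite gt_eqF.
  rewrite mulr_gt0 ?pi_gt0 ?divr_gt0 ?ltr0n//=.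
  by rewrite gtr_pMr ?pi_gt0// ltr_pdivrMr// mul1r ltr_nat.
have s20 : 2 * sin (theta / 2) != 0 by rewrite mulf_neq0.
apply: (mulfI s20); rewrite mulr0 sum_cos_telescope.
have -> : x + L%:R * theta - theta / 2 = (x - theta / 2) + p%:R * (pi *+ 2).
  by rewrite /theta; field; rewrite gt_eqF.
by rewrite sinD2pin subrr.
Qed.

(** With [z = x / 2 >= 0], the mean value theorem gives [sin z >= z cos z], so [sin x = 2 sin z cos
    z >= 2 z cos^2 z = z (1 + cos x) >= z]. *)
Lemma norm_sin_ge x : `|x| <= pi / 2 -> `|x| / 2 <= `|sin x|.
Proof.
wlog x0 : x / 0 <= x.
  move=> wl; case: (leP 0 x) => [|/ltW] h; first exact: wl.
  by rewrite -normrN -(normrN (sin x)) -sinN; apply: wl; rewrite oppr_ge0.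
rewrite ger0_norm// => xpi.
set z := x / 2.
have z0 : 0 <= z by rewrite divr_ge0.
have pi0 := pi_gt0 R.
have zx : z <= x by rewrite /z; lra.
have cz0 : 0 <= cos z.
  by apply: cos_ge0_pihalf; apply/andP; split; rewrite /z; lra.
have sz : z * cos z <= sin z.
  have [|c] := @MVT_segment R sin cos 0 z z0.
  - by apply: continuous_subspaceT; exact: continuous_sin.
  - rewrite in_itv/= sin0 !subr0 => /andP[c0 cz] ->.
    rewrite mulrC ler_wpM2r//.
    have [->//|czn] := eqVneq c z.
    have zpi : z \in `[0, pi] by rewrite in_itv/= z0/= /z; lra.
    have cpi : c \in `[0, pi] by rewrite in_itv/= c0/=; rewrite /z in cz; lra.
    by apply: ltW; rewrite (ltr_cos cpi zpi) lt_neqAle czn.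
have x2z : x = z *+ 2 by rewrite /z -mulr_natr; field.
have c2 : 1 <= cos z ^+ 2 *+ 2.
  have : 0 <= cos x by apply: cos_ge0_pihalf; apply/andP; split; lra.
  by rewrite x2z cos_mulr2n; lra.
apply: le_trans (ler_norm _); rewrite [in leRHS]x2z sin_mulr2n -/z.
apply: (@le_trans _ _ (z * (cos z ^+ 2 *+ 2))); first by rewrite ler_peMr.
rewrite expr2 -mulrnAr; nra.
Qed.

End trigonometric_sums.

Section spectral_form.
Variable R : realType.

(* [|sum_j c_j exp(i l t_j)|^2] *)
Definition spectral_form n (t c : 'I_n -> R) (l : R) : R :=
  (\sum_i c i * cos (l * t i)) ^+ 2 + (\sum_i c i * sin (l * t i)) ^+ 2.

Variables (n : nat) (t c : 'I_n -> R).
Local Notation Q := (spectral_form t c).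

Lemma spectral_form_ge0 l : 0 <= Q l.
Proof. by rewrite addr_ge0 ?sqr_ge0. Qed.

Lemma spectral_formE l :
  Q l = \sum_i \sum_j c i * c j * cos (l * (t j - t i)).
Proof.
rewrite /spectral_form !expr2 !big_distrlr /= -big_split; apply: eq_bigr => i _.
rewrite -big_split; apply: eq_bigr => j _ /=.
by rewrite mulrBr cosB; ring.
Qed.

Lemma measurable_spectral_form : measurable_fun setT Q.
Proof.
have mM u : measurable_fun setT (fun l : R => l * u) by exact: measurable_funM.
have mcos : measurable_fun [set: R] (@cos R).
  by apply: continuous_measurable_fun; exact: continuous_cos.
have msin : measurable_fun [set: R] (@sin R).
  by apply: continuous_measurable_fun; exact: continuous_sin.
by apply: measurable_funD; apply: measurable_funX; apply: measurable_sum => i;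
  apply: measurable_funM => //; exact: (measurableT_comp _ (mM (t i))).
Qed.

Lemma spectral_form_le l : Q l <= \sum_i \sum_j `|c i * c j|.
Proof.
rewrite spectral_formE; apply: ler_sum => i _; apply: ler_sum => j _.
by rewrite (le_trans (ler_norm _))// normrM ler_piMr// cos_max.
Qed.

Lemma spectral_form_lipschitz l l' : `|Q l - Q l'| <=
  (\sum_i \sum_j `|c i * c j * (t j - t i)|) * `|l - l'|.
Proof.
rewrite !spectral_formE -sumrB mulr_suml (le_trans (ler_norm_sum _ _ _))//.
apply: ler_sum => i _; rewrite -sumrB mulr_suml (le_trans (ler_norm_sum _ _ _))//.
apply: ler_sum => j _; rewrite -mulrBr normrM [in leRHS]normrM -mulrA ler_wpM2l//.
by rewrite (le_trans (cos_lipschitz _ _))// -mulrBl normrM mulrC.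
Qed.

Variable rho : {measure set R -> \bar R}.
Hypothesis rho_fin : (rho setT < +oo)%E.

Lemma integrable_spectral_form A : measurable A -> rho.-integrable A (EFin \o Q).
Proof.
move=> mA; apply: (@bounded_integrable _ _ _ _ _ _ (\sum_i \sum_j `|c i * c j|)) => //.
- by apply: le_lt_trans rho_fin; rewrite le_measure ?inE.
- by apply: measurable_funTS; exact: measurable_spectral_form.
- by move=> l _; rewrite ger0_norm ?spectral_form_ge0// spectral_form_le.
Qed.

(** The bridge from the process to [rho]: every variance estimate below is an estimate of this
    integral. *)
Lemma variance_spectral :
  \sum_(i < n) \sum_(j < n) c i * c j * covariance_of rho (t j - t i) =
  \int[rho]_l Q l.
Proof.
have ic u : rho.-integrable setT (EFin \o (fun l => cos (l * u))).
  apply: (@bounded_integrable _ _ _ _ _ _ 1) => //; last by move=> l _; exact: cos_max.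
  apply: (measurableT_comp (g := fun l : R => l * u)); last exact: measurable_funM.
  by apply: continuous_measurable_fun; exact: continuous_cos.
under [in RHS]eq_Rintegral do rewrite spectral_formE.
rewrite Rintegral_sum//; last first.
  by move=> i; apply: integrable_sum_EFin => // j; apply: integrableZl_EFin.
apply: eq_bigr => i _; rewrite Rintegral_sum//; last first.
  by move=> j; apply: integrableZl_EFin.
by apply: eq_bigr => j _; rewrite RintegralZl.
Qed.

End spectral_form.

(** * Variance bounds *)

Section spectral_lower_bound.
Variables (R : realType) (rho : {measure set R -> \bar R}) (a m : R).
Hypothesis rho_fin : (rho setT < +oo)%E.
Hypothesis m0 : 0 <= m.
Hypothesis rho_ge : forall i : interval R, [set` i] `<=` `]- a, a[ ->
  ((m * itv_length i)%:E <= rho [set` i])%E.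

Lemma measure_fin_num (A : set R) : measurable A -> rho A \is a fin_num.
Proof.
move=> mA; rewrite ge0_fin_numE//.
by apply: le_lt_trans rho_fin; rewrite le_measure ?inE.
Qed.

(** Since [rho] is compared with length on intervals only, the integral is cut into cells: on a cell
    of length [h], [Q] stays above its value at the left end minus [Lam * h], and the mass is at
    least [m * h]. *)
Lemma riemann_sum_le_Rintegral (Q : R -> R) (Lam x0 h : R) (L : nat) :
  (forall x, 0 <= Q x) -> rho.-integrable setT (EFin \o Q) ->
  (forall x y, `|Q x - Q y| <= Lam * `|x - y|) -> 0 <= Lam ->
  0 < h -> - a < x0 -> x0 + L%:R * h < a ->
  \sum_(i < L) (Q (x0 + i%:R * h) - Lam * h) * (m * h) <= \int[rho]_x Q x.
Proof.
move=> Q0 iQ lipQ Lam0 h0 ax0 xLa.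
have iQA A : measurable A -> rho.-integrable A (EFin \o Q).
  by move=> mA; apply: integrableS iQ.
have h0' : 0 <= h by exact: ltW.
suff H k : (k <= L)%N -> \sum_(i < k) (Q (x0 + i%:R * h) - Lam * h) * (m * h) <=
    \int[rho]_(x in `[x0, x0 + k%:R * h[) Q x.
  apply: (le_trans (H L (leqnn L))).
  rewrite /Rintegral fine_le//.
  - by apply: integrable_fin_num => //; exact: iQA.
  - by apply: integrable_fin_num.
  - apply: ge0_subset_integral => //; first exact: (measurable_int rho).
    by move=> x _; rewrite lee_fin.
elim: k => [_|k ih kL].
  by rewrite big_ord0 Rintegral_ge0.
have xk : x0 <= x0 + k%:R * h by rewrite lerDl mulr_ge0.
have xkk : x0 + k%:R * h < x0 + k.+1%:R * h.
  by rewrite ltrD2l ltr_pM2r// ltr_nat.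
rewrite (@itv_bndbnd_setU _ _ _ (BLeft (x0 + k%:R * h))); last 2 first.
- by rewrite bnd_simp.
- by rewrite bnd_simp ltW.
rewrite Rintegral_setU//; last 2 first.
- by apply: iQA; exact: measurableU.
- apply/disj_setPS => y [/=]; rewrite 2!in_itv/= => /andP[_ yx] /andP[].
  by rewrite leNgt yx.
rewrite big_ord_recr/= lerD//; first by rewrite ih// ltnW.
set I := `[_, _[%classic.
set xk_ := x0 + k%:R * h in xk xkk I *.
have hE : x0 + k.+1%:R * h - xk_ = h by rewrite /xk_ -natr1; ring.
(* The lower bound on the cell may be negative, and then a lower bound on the mass would go the
   wrong way; truncating at 0 avoids this. *)
pose c := Num.max 0 (Q xk_ - Lam * h).
have c0 : 0 <= c by rewrite le_max lexx.
have rhoI : m * h <= fine (rho I).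
  have : `[xk_, x0 + k.+1%:R * h[ `<=` `]- a, a[.
    apply: subset_itv; rewrite bnd_simp; first exact: lt_le_trans ax0 xk.
    rewrite (le_trans _ (ltW xLa))// lerD2l ler_wpM2r// ler_nat//.
  move=> /rho_ge; rewrite /itv_length hE max_r// => mh.
  by rewrite -lee_fin fineK//; apply: measure_fin_num; exact: measurable_itv.
apply: (@le_trans _ _ (c * fine (rho I))).
  apply: (@le_trans _ _ (c * (m * h))); last exact: ler_wpM2l.
  by rewrite ler_wpM2r ?mulr_ge0// le_max lexx orbT.
have <- : \int[rho]_(x in I) c = c * fine (rho I).
  by rewrite Rintegral_cst//; exact: measurable_itv.
apply: (@le_Rintegral _ _ _ rho I (cst c) Q); first exact: measurable_itv.
- apply: (@bounded_integrable _ _ _ _ _ _ `|c|) => //.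
  + exact: measurable_itv.
  + by rewrite ltey_eq measure_fin_num//; exact: measurable_itv.
- by apply: iQA; exact: measurable_itv.
- move=> x; rewrite /I /= in_itv/= => /andP[x1 x2].
  rewrite /c ge_max Q0/= lerBlDr.
  have : Q xk_ - Q x <= Lam * h.
    apply: le_trans (ler_norm _) _; apply: le_trans (lipQ _ _) _.
    by rewrite ler_wpM2l// ler_norml; apply/andP; split; lra.
  by rewrite lerBlDl.
Qed.

(** Discrete orthogonality over [L] points equally dividing the period [2 pi / s]: the terms with
    [i <> j] cancel because [0 < |i - j| < L]. *)
Lemma spectral_form_equispaced (s u x0 : R) n (e : 'I_n -> R) (L : nat) :
  0 < s -> (0 < L)%N -> (n <= L)%N ->
  \sum_(k < L) spectral_form (fun i : 'I_n => u + s * i%:R) e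
     (x0 + k%:R * (pi *+ 2 / (s * L%:R))) = L%:R * \sum_i e i ^+ 2.
Proof.
move=> s0 L0 nL.
under eq_bigr do rewrite spectral_formE.
rewrite exchange_big mulr_sumr; apply: eq_bigr => i _ /=.
rewrite exchange_big (bigD1 i)//= [X in _ + X]big1 ?addr0 => [|j ji].
  under eq_bigr do rewrite subrr mulr0 cos0 mulr1.
  by rewrite sumr_const card_ord -[LHS]mulr_natl expr2.
rewrite -mulr_sumr.
pose p := if (i < j)%N then (j - i)%N else (i - j)%N.
have pL : (0 < p < L)%N.
  have := ltn_ord i; have := ltn_ord j; move: ji; rewrite -val_eqE/= /p.
  by case: (ltngtP i j); lia.
rewrite (_ : \sum_(k < L) _ = 0) ?mulr0//.
rewrite -[RHS](sum_cos_eq0 (x0 * s * p%:R) pL); apply: eq_bigr => k _.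
have L00 : L%:R != 0 :> R by rewrite pnatr_eq0 -lt0n.
have ss0 : s != 0 by rewrite gt_eqF.
rewrite /p; case: (ltnP i j) => ij.
  by congr cos; rewrite natrB ?(ltnW ij)//; field; rewrite L00.
by rewrite -cosN; congr cos; rewrite natrB//; field; rewrite L00.
Qed.

(** The condition [pi / s < a] puts the full period [[- pi / s, pi / s]] inside [(-a, a)]. There
    [spectral_form_equispaced] evaluates the Riemann sum exactly, so only the Lipschitz error
    remains, and it vanishes with the mesh. *)
Lemma variance_lower_bound (s u : R) n (e : 'I_n -> R) :
  0 < s -> pi / s < a ->
  m * (pi *+ 2 / s) * \sum_i e i ^+ 2 <=
  \int[rho]_l spectral_form (fun i : 'I_n => u + s * i%:R) e l.
Proof.
move=> s0 sa.
set t := fun i : 'I_n => _; set Q := spectral_form t e.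
pose Lam := \sum_i \sum_j `|e i * e j * (t j - t i)|.
pose per : R := pi *+ 2 / s.
have per0 : 0 < per by rewrite divr_gt0// pmulrn_lgt0// pi_gt0.
have Lam0 : 0 <= Lam by apply: sumr_ge0 => i _; apply: sumr_ge0.
have H (L : nat) : (n < L)%N ->
    m * per * \sum_i e i ^+ 2 - m * Lam * per ^+ 2 / L%:R <= \int[rho]_l Q l.
  move=> nL.
  have L0 : (0 < L)%N by exact: leq_ltn_trans nL.
  have L00 : L%:R != 0 :> R by rewrite pnatr_eq0 -lt0n.
  have ss0 : s != 0 by rewrite gt_eqF.
  pose h : R := pi *+ 2 / (s * L%:R).
  have h0 : 0 < h by apply: divr_gt0; [rewrite pmulrn_lgt0// pi_gt0|rewrite mulr_gt0// ltr0n].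
  have Lh : L%:R * h = per by rewrite /h /per; field; rewrite ss0 L00.
  have iQ : rho.-integrable setT (EFin \o Q) by exact: integrable_spectral_form.
  have := @riemann_sum_le_Rintegral Q Lam (- (pi / s)) h L
     (spectral_form_ge0 _ _) iQ (spectral_form_lipschitz _ _) Lam0 h0.
  rewrite ltrN2 Lh => /(_ sa).
  have -> : - (pi / s) + per = pi / s by rewrite /per; field.
  move=> /(_ sa); apply: le_trans.
  rewrite -mulr_suml sumrB (spectral_form_equispaced u _ e s0 L0 (ltnW nL)).
  rewrite sumr_const card_ord -[Lam * h *+ L]mulr_natr -Lh.
  rewrite le_eqVlt; apply/orP; left; apply/eqP; field.
  by rewrite L00.
rewrite -/per -/Q; apply/ler_addgt0Pr => eps eps0.
pose K := m * Lam * per ^+ 2.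
have K0 : 0 <= K by rewrite mulr_ge0 ?sqr_ge0 ?mulr_ge0.
(* More than [n] points for orthogonality, more than [K / eps] for an error below [eps]. *)
pose L := maxn n.+1 (Num.truncn (K / eps)).+1.
have nL : (n < L)%N by rewrite /L leq_maxl.
have KL : K / L%:R <= eps.
  rewrite ler_pdivrMr ?ltr0n ?(leq_ltn_trans _ nL)// mulrC -ler_pdivrMr//.
  apply: (@le_trans _ _ (Num.truncn (K / eps)).+1%:R); last by rewrite ler_nat leq_maxr.
  by rewrite ltW// truncnS_gt.
by have := H L nL; rewrite -/K lerBlDr => /le_trans; apply; rewrite lerD2l.
Qed.

End spectral_lower_bound.

Section spectral_upper_bound.
Variable R : realType.

Lemma spectral_form_mean_le1 (N : nat) (eta l : R) : (0 < N)%N ->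
  spectral_form (fun i : 'I_N => eta * i%:R) (fun=> N%:R^-1) l <= 1.
Proof.
move=> N0; apply: le_trans (spectral_form_le _ _ _) _.
under eq_bigr do rewrite sumr_const card_ord.
rewrite sumr_const card_ord ger0_norm ?mulr_ge0 ?invr_ge0//.
have N00 : N%:R != 0 :> R by rewrite pnatr_eq0 -lt0n.
rewrite -mulrnA -[leLHS]mulr_natr natrM le_eqVlt; apply/orP; left; apply/eqP; field.
by rewrite N00.
Qed.

(* Away from the frequencies in (2 pi / eta) Z, the Dirichlet kernel decays. *)
Lemma spectral_form_mean_decay (N : nat) (eta l : R) :
  (0 < N)%N -> `|l * eta| <= pi ->
  spectral_form (fun i : 'I_N => eta * i%:R) (fun=> N%:R^-1) l *
    (N%:R * eta * l) ^+ 2 <= 32.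
Proof.
move=> N0 lpi.
have N00 : N%:R != 0 :> R by rewrite pnatr_eq0 -lt0n.
have sge : `|l * eta| / 4 <= `|sin (l * eta / 2)|.
  have := @norm_sin_ge R (l * eta / 2); rewrite normrM [`|2^-1|]ger0_norm//.
  rewrite ler_pM2r// => /(_ lpi); apply: le_trans.
  by rewrite le_eqVlt; apply/orP; left; apply/eqP; field.
have H x : (\sum_(k < N) cos (x + k%:R * (l * eta))) ^+ 2 * (l * eta) ^+ 2 <= 16.
  set S := \sum_(k < N) _.
  have : `|l * eta| / 4 * `|S| <= 1.
    by apply: le_trans (sum_cos_sin_le1 x (l * eta) N); rewrite [leRHS]normrM ler_wpM2r.
  move=> h.
  have h4 : `|S * (l * eta)| <= 4 by rewrite normrM; lra.
  rewrite -exprMn -real_normK ?num_real// (_ : 16 = 4 ^+ 2); last by ring.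
  by rewrite lerXn2r ?nnegrE.
(* The sine sum is a cosine sum with phase [- pi / 2], so [H] bounds both squares and
   [32 = 16 + 16]. *)
have -> : spectral_form (fun i : 'I_N => eta * i%:R) (fun=> N%:R^-1) l *
    (N%:R * eta * l) ^+ 2 =
  (\sum_(k < N) cos (0 + k%:R * (l * eta))) ^+ 2 * (l * eta) ^+ 2 +
  (\sum_(k < N) cos (- (pi / 2) + k%:R * (l * eta))) ^+ 2 * (l * eta) ^+ 2.
  rewrite /spectral_form -!mulr_sumr.
  have -> : \sum_(i < N) cos (l * (eta * i%:R)) =
      \sum_(k < N) cos (0 + k%:R * (l * eta)).
    by apply: eq_bigr => i _; congr cos; ring.
  have -> : \sum_(i < N) sin (l * (eta * i%:R)) =
      \sum_(k < N) cos (- (pi / 2) + k%:R * (l * eta)).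
    by apply: eq_bigr => i _; rewrite -cosBpihalf; congr cos; ring.
  by field.
by rewrite (_ : 32 = 16 + 16) ?lerD//; ring.
Qed.

(** For [b > 0] the indicators equal to 1 are those with [k >= floor(x / b)], so the right-hand side
    telescopes to [g (floor(x / b))], or to [g n] when [x >= n b]. Decay in [|l|] thus becomes a
    combination of indicators of centred intervals, whose mass is controlled. *)
Lemma layer_cake_le (g : nat -> R) (b x F : R) (n : nat) :
  (forall k, g k.+1 <= g k) -> (forall k, k%:R * b <= x -> F <= g k) -> 0 <= x ->
  F <= \sum_(k < n) (g k - g k.+1) * (x < k.+1%:R * b)%R%:R + g n.
Proof.
move=> ng Fg x0; elim: n => [|n ih].
  by rewrite big_ord0 add0r; apply: Fg; rewrite mul0r.
case: (ltP x (n.+1%:R * b)) => xn.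
  rewrite big_ord_recr/= xn mulr1.
  by rewrite -addrA subrK.
apply: (le_trans (Fg _ xn)); rewrite lerDr; apply: sumr_ge0 => k _.
by rewrite mulr_ge0// subr_ge0.
Qed.

Lemma sum_layers_le8 n :
  \sum_(k < n) (4 / k.+1%:R ^+ 2 - 4 / k.+2%:R ^+ 2) * k.+1%:R <= 8 :> R.
Proof.
(* The subtracted term closes the induction: with [x = n + 1], each step has [4 / (x (x + 1)^2)] to
   spare. *)
suff H : \sum_(k < n) (4 / k.+1%:R ^+ 2 - 4 / k.+2%:R ^+ 2) * k.+1%:R <=
    8 - 8 / n.+1%:R :> R.
  by apply: (le_trans H); rewrite gerBl divr_ge0.
elim: n => [|n ih]; first by rewrite big_ord0 divr1 subrr.
rewrite big_ord_recr/=.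
apply: (le_trans (lerD ih (lexx _))).
rewrite -(natr1 n.+1); set x : R := n.+1%:R.
have x0 : 0 < x by rewrite ltr0n.
rewrite -subr_ge0.
have -> : 8 - 8 / (x + 1) - (8 - 8 / x + (4 / x ^+ 2 - 4 / (x + 1) ^+ 2) * x) =
   4 / (x * (x + 1) ^+ 2).
  by field; rewrite !gt_eqF// ltr_wpDr.
by rewrite divr_ge0// mulr_ge0 ?sqr_ge0 ?ltW.
Qed.

Variables (rho : {measure set R -> \bar R}) (a M : R).
Hypothesis rho_fin : (rho setT < +oo)%E.
Hypothesis a0 : 0 < a.
Hypothesis M0 : 0 <= M.
Hypothesis rho_le : forall i : interval R, [set` i] `<=` `]- a, a[ ->
  (rho [set` i] <= (M * itv_length i)%:E)%E.

(** The three terms come from the layers inside [(-a, a)], from the other frequencies up to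
    [pi / eta], where the kernel is at most [4 / (n + 1)^2], and from those beyond, where it is at
    most 1. *)
Lemma variance_mean_le (n N : nat) (eta : R) : (0 < n)%N -> (0 < N)%N ->
  0 < eta -> 8 * n%:R <= N%:R * eta * a ->
  \int[rho]_l spectral_form (fun i : 'I_N => eta * i%:R) (fun=> N%:R^-1) l <=
  16 * M * a / n%:R + 4 / n.+1%:R ^+ 2 * fine (rho setT)
  + fine (rho (~` `[- (pi / eta), pi / eta])).
Proof.
move=> n0 N0 eta0 hW.
set Q := spectral_form _ _.
set Out : set R := ~` _.
pose b : R := a / n%:R.
have nR : 0 < n%:R :> R by rewrite ltr0n.
have b0 : 0 < b by rewrite divr_gt0.
(* For [k >= 1] and [k b <= |l| <= pi / eta], the bound [N * eta * b >= 8] turns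
   [spectral_form_mean_decay] into [Q l <= 32 / (8 k)^2 <= 1 / k^2], and [(k + 1)^2 <= 4 k^2] makes
   this at most [g k]. The value [g 0 = 4] covers the trivial bound 1. *)
pose g (k : nat) : R := 4 / k.+1%:R ^+ 2.
have g0 k : 0 <= g k by rewrite divr_ge0// sqr_ge0.
have ng k : g k.+1 <= g k.
  rewrite ler_pM2l// lef_pV2 ?posrE ?exprn_gt0 ?ltr0n//.
  by rewrite lerXn2r ?nnegrE// ler_nat.
have Wb : 8 <= N%:R * eta * b.
  by rewrite /b mulrA ler_pdivlMr.
have W0 : 0 < N%:R * eta by rewrite mulr_gt0// ltr0n.
have Qg l k : ~ Out l -> k%:R * b <= `|l| -> Q l <= g k.
  move=> nO; case: k => [_|k kb].
    by apply: (le_trans (spectral_form_mean_le1 _ _ N0)); rewrite /g expr1n divr1 ler1n.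
  have lpi : `|l * eta| <= pi.
    have : `[- (pi / eta), pi / eta]%classic l by apply: contrapT.
    rewrite /= in_itv/= -ler_norml => h.
    by rewrite normrM (gtr0_norm eta0) -ler_pdivlMr.
  have := spectral_form_mean_decay N0 lpi; rewrite -/Q => dec.
  have kk : 8 * k.+1%:R <= N%:R * eta * `|l|.
    apply: (@le_trans _ _ (N%:R * eta * (k.+1%:R * b))); last by rewrite ler_pM2l.
    by rewrite (mulrC k.+1%:R) mulrA ler_wpM2r.
  have k1 : 1 <= k.+1%:R :> R by rewrite ler1n.
  have Ql0 : 0 <= Q l by exact: spectral_form_ge0.
  rewrite /g -(natr1 k.+1); move: k1 kk; set x : R := k.+1%:R => k1 kk.
  rewrite ler_pdivlMr; last by rewrite exprn_gt0// ltr_wpDr// (lt_le_trans ltr01).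
  have sq : (8 * x) ^+ 2 <= (N%:R * eta * l) ^+ 2.
    rewrite -[leRHS]real_normK ?num_real// normrM (gtr0_norm W0).
    have x8 : 0 <= 8 * x by lra.
    have Wl : 0 <= N%:R * eta * `|l| by rewrite mulr_ge0// ltW.
    by rewrite lerXn2r ?nnegrE.
  have : Q l * (8 * x) ^+ 2 <= 32.
    by apply: le_trans dec; exact: ler_wpM2l.
  have : (x + 1) ^+ 2 <= 4 * x ^+ 2 by nra.
  move=> /(ler_wpM2l Ql0) h1 h2; apply: (le_trans h1); lra.
pose J (k : nat) : set R := `](- (k.+1%:R * b)), (k.+1%:R * b)[%classic.
have mOut : measurable Out by apply: measurableC.
have Qle l : Q l <= \sum_(k < n) (g k - g k.+1) * \1_(J k) l + (g n + \1_Out l).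
  have [lO|lO] := boolP (l \in Out).
    rewrite [\1_Out l]indicE lO.
    apply: (le_trans (spectral_form_mean_le1 _ _ N0)).
    rewrite addrA lerDr addr_ge0//; apply: sumr_ge0 => k _.
    by rewrite mulr_ge0 ?subr_ge0// indicE.
  rewrite [\1_Out l]indicE (negbTE lO) addr0.
  have := @layer_cake_le g b `|l| (Q l) n ng.
  have nOl : ~ Out l by move=> h; move/negP: lO; apply; rewrite inE.
  move=> /(_ (fun k => @Qg l k nOl) (normr_ge0 _)) h; apply: (le_trans h).
  rewrite lerD2r; apply: ler_sum => k _; rewrite ler_wpM2l ?subr_ge0//.
  by rewrite indicE /J mem_setE in_itv/= -ltr_norml.
have rfin A : measurable A -> rho A \is a fin_num by exact: measure_fin_num.
have i1 A : measurable A -> rho.-integrable setT (EFin \o \1_A).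
  move=> mA; apply: (@bounded_integrable _ _ _ _ _ _ 1) => //.
  by move=> x _; rewrite indicE; case: (_ \in _); rewrite ?normr1 ?normr0.
have I1 A : measurable A -> \int[rho]_l \1_A l = fine (rho A).
  by move=> mA; rewrite /Rintegral integral_indic// setIT.
have mJ k : measurable (J k) by exact: measurable_itv.
have iJ k : rho.-integrable setT (EFin \o (fun l => (g k - g k.+1) * \1_(J k) l)).
  by apply: integrableZl_EFin => //; exact: i1.
have iS : rho.-integrable setT (EFin \o (fun l => \sum_(k < n) (g k - g k.+1) * \1_(J k) l)).
  by apply: integrable_sum_EFin.
have ic : rho.-integrable setT (EFin \o (fun=> g n)).
  by apply: (@bounded_integrable _ _ _ _ _ _ `|g n|).
have igO : rho.-integrable setT (EFin \o (fun l => g n + \1_Out l)).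
  have -> : EFin \o (fun l => g n + \1_Out l) = (fun l => (g n)%:E + (\1_Out l)%:E)%E by [].
  by apply: integrableD => //; exact: i1.
have iQ : rho.-integrable setT (EFin \o Q) by exact: integrable_spectral_form.
have iR : rho.-integrable setT (EFin \o
    (fun l => \sum_(k < n) (g k - g k.+1) * \1_(J k) l + (g n + \1_Out l))).
  by rewrite [X in _.-integrable _ X](_ : _ = (fun l =>
    (\sum_(k < n) (g k - g k.+1) * \1_(J k) l)%:E + (g n + \1_Out l)%:E)%E)//;
    apply: integrableD.
apply: (le_trans (le_Rintegral measurableT iQ iR (fun l _ => Qle l))).
rewrite RintegralD// RintegralD//; last exact: i1.
rewrite I1// Rintegral_cst// addrA lerD2r lerD2r Rintegral_sum//.
have rJ (k : 'I_n) : fine (rho (J k)) <= M * (2 * k.+1%:R * b).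
  have kb0 : 0 < k.+1%:R * b by rewrite mulr_gt0.
  have : J k `<=` `]- a, a[.
    have kba : k.+1%:R * b <= a.
      rewrite /b mulrCA ler_piMr ?(ltW a0)// ler_pdivrMr// mul1r ler_nat.
      exact: ltn_ord.
    by apply: subset_itv; rewrite bnd_simp ?lerN2.
  move=> /rho_le; rewrite /itv_length max_r; last by lra.
  have -> : k.+1%:R * b - - (k.+1%:R * b) = 2 * k.+1%:R * b by ring.
  by rewrite -[X in (X <= _)%E -> _]fineK ?lee_fin//; exact: rfin.
apply: (@le_trans _ _ (\sum_(k < n) (2 * M * b) * ((g k - g k.+1) * k.+1%:R))).
  apply: ler_sum => k _; rewrite RintegralZl ?I1//; last exact: i1.
  apply: (@le_trans _ _ ((g k - g k.+1) * (M * (2 * k.+1%:R * b)))).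
    by rewrite ler_wpM2l ?subr_ge0.
  by rewrite le_eqVlt; apply/orP; left; apply/eqP; ring.
rewrite -mulr_sumr.
apply: (@le_trans _ _ (2 * M * b * 8)).
  by rewrite ler_wpM2l ?sum_layers_le8// mulr_ge0 ?(ltW b0)// mulr_ge0.
by rewrite le_eqVlt; apply/orP; left; apply/eqP; rewrite /b; field; rewrite gt_eqF.
Qed.

End spectral_upper_bound.

(** * Gap probabilities *)

Section gap_event_measurable.
Context (R : realType) d (Omega : measurableType d) (f : R -> Omega -> R).

Lemma measurable_ge_set (g : Omega -> R) (x : R) : measurable_fun setT g ->
  measurable [set w | x <= g w].
Proof.
move=> mg; rewrite (_ : [set w | x <= g w] = setT `&` g @^-1` `[x, +oo[%classic).
  exact: mg.
by rewrite setTI; apply/seteqP; split => w /=; rewrite in_itv/= andbT.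
Qed.

Lemma measurable_gt_set (g : Omega -> R) (x : R) : measurable_fun setT g ->
  measurable [set w | x < g w].
Proof.
move=> mg; rewrite (_ : [set w | x < g w] = setT `&` g @^-1` `]x, +oo[%classic).
  exact: mg.
by rewrite setTI; apply/seteqP; split => w /=; rewrite in_itv/= andbT.
Qed.

(** In continuous time positivity at rational times is not enough, as [f] could vanish at an
    irrational one. The event is rewritten as: on each [[0, N - 1/(k+1)]] the values at rationals
    have a common lower bound [1/(l+1)]. Compactness provides the bound; density and continuity give
    the converse. *)
Lemma measurable_gap_event (discrete : bool) (N : R) :
  (forall t, time_set discrete t -> measurable_fun setT (f t)) ->
  (~~ discrete -> forall w, continuous (f ^~ w)) ->
  measurable (gap_event discrete f N).
Proof.
case: discrete => /= mf cf.
  pose A k := if k%:R < N then [set w | 0 < f k%:R w] else setT.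
  have -> : gap_event true f N = \bigcap_(k in [set: nat]) A k.
    apply/seteqP; split => w /=.
      move=> gw k _; rewrite /A; case: ifPn => // kN /=.
      by apply: gw => //; exists (Posz k).
    move=> Aw t [[k|k] ->]; last by rewrite NegzE mulrNz oppr_ge0 lern0.
    by move=> _ kN; have := Aw k I; rewrite /A ifT.
  apply: bigcap_measurable => [|k _]; first by exists 0%N.
  rewrite /A; case: ifPn => // _; apply: measurable_gt_set.
  by apply: mf; exists (Posz k).
have {}cf := cf isT.
pose c (k : nat) := N - k.+1%:R^-1.
pose B (k l : nat) (q : rat) := if (0 <= (ratr q : R) <= c k)%R
  then [set w | l.+1%:R^-1 <= f (ratr q) w] else setT.
have -> : gap_event false f N =
    \bigcap_(k in [set: nat]) \bigcup_l \bigcap_q B k l q.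
  apply/seteqP; split => w /=.
    move=> gw k _.
    case: (leP 0 (c k)) => ck; last first.
      exists 0%N => // q _; rewrite /B; case: ifPn => // /andP[q0 qc].
      by have := le_lt_trans (le_trans q0 qc) ck; rewrite ltxx.
    have [t0 t0c ft0] := EVT_min ck (continuous_subspaceT (cf w)).
    have ckN : c k < N by rewrite /c gtrBl invr_gt0 ltr0n.
    have f0 : 0 < f t0 w.
      by move: t0c; rewrite in_itv/= => /andP[t1 t2]; apply: gw => //;
        exact: le_lt_trans ckN.
    have [l] := ltr_add_invr f0; rewrite add0r => lf.
    exists l => // q _; rewrite /B; case: ifPn => //= qc.
    by apply: (le_trans (ltW lf)); apply: ft0; rewrite in_itv.
  move=> gw t _ t0 tN.
  have [k tk] := ltr_add_invr tN.
  have [l _ Bl] := gw k I.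
  rewrite ltNge; apply/negP => ft.
  have l0 : 0 < l.+1%:R^-1 :> R by rewrite invr_gt0 ltr0n.
  have /cvgrPdist_lt/(_ _ l0)[e /= e0 he] := cf w t.
  (* If [f t w <= 0], a rational slightly to the right of [t] still lies in the range of [B k l],
     yet [f] is below [1/(l+1)] there. *)
  have tc : t < Num.min (t + e) (c k).
    by rewrite lt_min ltrDl e0/= /c ltrBrDr.
  have [q] := rat_in_itvoo tc.
  rewrite in_itv/= lt_min => /andP[tq /andP[qe qc]].
  have := Bl q I; rewrite /B ifT; last by rewrite (ltW qc) andbT (le_trans t0)// ltW.
  have := he (ratr q); rewrite /= ltr0_norm ?subr_lt0// opprB ltrBlDl => /(_ qe).
  rewrite distrC => /ltr_normlW h /= h2.
  by have := le_lt_trans (lerB h2 ft) h; rewrite subr0 ltxx.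
apply: bigcap_measurable => [|k _]; first by exists 0%N.
apply: bigcup_measurable => l _.
rewrite -[X in measurable X]setCK setC_bigcap; apply: measurableC.
apply: bigcupT_measurable_rat => q; apply: measurableC.
by rewrite /B; case: ifPn => // _; apply: measurable_ge_set; exact: mf.
Qed.

End gap_event_measurable.

Section product_of_cosines.
Context (R : realType) d (Omega : measurableType d) (P : probability Omega R).

Lemma prob_bounded_integrable (g : Omega -> R) (B : R) :
  measurable_fun setT g -> (forall w, `|g w| <= B) ->
  P.-integrable setT (EFin \o g).
Proof.
move=> mg gB; apply: (@bounded_integrable _ _ _ _ _ _ B) => //.
by rewrite ltey_eq fin_num_measure.
Qed.

Lemma measurable_cos_comp (g : Omega -> R) :
  measurable_fun setT g -> measurable_fun setT (fun w => cos (g w)).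
Proof.
apply: measurableT_comp.
by apply: continuous_measurable_fun; exact: continuous_cos.
Qed.

Variables (n : nat) (X : 'I_n -> Omega -> R) (v : R).
Hypothesis mX : forall j, measurable_fun setT (X j).
Hypothesis EX : forall c : 'I_n -> R,
  \int[P]_w cos (\sum_j c j * X j w) <= expR (- (v * \sum_j c j ^+ 2)).

Let q := expR (- v).

(* Each factor [2 + cos X_k] is absorbed into the argument of the leading cosine:
   [cos y (2 + cos x) = 2 cos y + (cos (y + x) + cos (y - x)) / 2]. *)
Lemma expectation_prod_cos_aux k (c : 'I_n -> R) : (k <= n)%N ->
  (forall j : 'I_n, (j < k)%N -> c j = 0) ->
  \int[P]_w (cos (\sum_j c j * X j w) * \prod_(j < n | (j < k)%N) (2 + cos (X j w)))
  <= (2 + q) ^+ k * expR (- (v * \sum_j c j ^+ 2)).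
Proof.
have mS (e : 'I_n -> R) : measurable_fun setT (fun w => \sum_j e j * X j w).
  by apply: measurable_sum => j; exact: measurable_funM.
have prodB k0 w : `|\prod_(j < n | (j < k0)%N) (2 + cos (X j w))| <= 3 ^+ n.
  rewrite normr_prod (le_trans (_ : _ <= \prod_(j < n | (j < k0)%N) 3))//.
    apply: ler_prod => j _; rewrite normr_ge0/=.
    rewrite ger0_norm; have := cos_geN1 (X j w); have := cos_le1 (X j w); lra.
  rewrite prodr_const ler_eXn2l//; last by rewrite ltr1n.
  by rewrite -[leqRHS](card_ord n); exact: max_card.
have mprod k0 : measurable_fun setT
    (fun w => \prod_(j < n | (j < k0)%N) (2 + cos (X j w))).
  under eq_fun do rewrite big_mkcond.
  apply: measurable_prod => j _; case: (ltnP j k0) => _; last exact: measurable_cst.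
  by apply: measurable_funD => //; exact: measurable_cos_comp.
have int_ k0 (e : 'I_n -> R) : P.-integrable setT (EFin \o (fun w =>
    cos (\sum_j e j * X j w) * \prod_(j < n | (j < k0)%N) (2 + cos (X j w)))).
  apply: (@prob_bounded_integrable _ (3 ^+ n)).
    by apply: measurable_funM => //; exact: measurable_cos_comp.
  by move=> w; rewrite normrM -[leRHS]mul1r ler_pM// cos_max.
elim: k c => [|k ih] c kn c0.
  rewrite expr0 mul1r; apply: le_trans (EX c).
  rewrite le_eqVlt; apply/orP; left; apply/eqP.
  by apply: eq_Rintegral => w _; rewrite [X in _ * X]big_pred0 ?mulr1.
pose kk := Ordinal kn.
(* Since [c] vanishes at index [k], putting [1] or [-1] there raises the sum of squares by exactly
   1, that is, yields one factor [q]; each step then contributes [2 + (q + q) / 2 = 2 + q]. *)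
pose ce (e : R) (j : 'I_n) := if j == kk then e else c j.
have ckk : c kk = 0 by apply: c0 => /=.
have ceS e w : \sum_j ce e j * X j w = \sum_j c j * X j w + e * X kk w.
  rewrite (bigD1 kk)//= [in RHS](bigD1 kk)//= ckk mul0r add0r addrC /ce eqxx.
  by congr (_ + _); apply: eq_bigr => j /negbTE ->.
have ce2 e : \sum_j ce e j ^+ 2 = \sum_j c j ^+ 2 + e ^+ 2.
  rewrite (bigD1 kk)//= [in RHS](bigD1 kk)//= ckk expr0n add0r addrC /ce eqxx.
  by congr (_ + _); apply: eq_bigr => j /negbTE ->.
have ce0 e (j : 'I_n) : (j < k)%N -> ce e j = 0.
  move=> jk; rewrite /ce; case: eqP => [jE|_]; first by move: jk; rewrite jE ltnn.
  by apply: c0; rewrite ltnW.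
have c0' (j : 'I_n) : (j < k)%N -> c j = 0 by move=> jk; apply: c0; rewrite ltnW.
pose F (e : 'I_n -> R) w := cos (\sum_j e j * X j w) *
  \prod_(j < n | (j < k)%N) (2 + cos (X j w)).
have Fstep w : cos (\sum_j c j * X j w) * \prod_(j < n | (j < k.+1)%N) (2 + cos (X j w))
   = 2 * F c w + (2^-1 * F (ce 1) w + 2^-1 * F (ce (-1)) w).
  rewrite [X in _ * X](bigD1 kk)//=.
  have -> : \prod_(j < n | (j < k.+1)%N && (j != kk)) (2 + cos (X j w)) =
     \prod_(j < n | (j < k)%N) (2 + cos (X j w)).
    by apply: eq_bigl => j; rewrite ltnS -val_eqE/= [RHS]ltn_neqAle andbC.
  rewrite /F !ceS mul1r mulN1r cosD cosB.
  by field.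
have iF e : P.-integrable setT (EFin \o F e) by exact: int_.
under eq_Rintegral do rewrite Fstep.
rewrite RintegralD//; first last.
- rewrite [X in _.-integrable _ X](_ : _ = (fun w =>
    (2^-1 * F (ce 1) w)%:E + (2^-1 * F (ce (-1)) w)%:E)%E)//.
  by apply: integrableD => //; exact: integrableZl_EFin.
- exact: integrableZl_EFin.
rewrite RintegralD//; [|exact: integrableZl_EFin|exact: integrableZl_EFin].
rewrite !RintegralZl//.
have kn' := ltnW kn.
have h0 := ih c kn' c0'.
have h1 := ih (ce 1) kn' (ce0 1).
have h2 := ih (ce (-1)) kn' (ce0 (-1)).
move: h1 h2; rewrite !ce2 sqrrN expr1n !mulrDr mulr1 opprD expRD -/q.
rewrite exprS -/(F c) => h1 h2.
set E := expR _ in h0 h1 h2 *; set T := (2 + q) ^+ k in h0 h1 h2 *.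
have -> : (2 + q) * T * E = 2 * (T * E) + (2^-1 * (T * (E * q)) + 2^-1 * (T * (E * q))).
  by field.
by rewrite lerD ?ler_pM2l// lerD// ler_pM2l.
Qed.

Lemma expectation_prod_cos_le :
  \int[P]_w \prod_(j < n) (2 + cos (X j w)) <= (2 + q) ^+ n.
Proof.
have := @expectation_prod_cos_aux n (fun=> 0) (leqnn n) (fun _ _ => erefl).
have -> : \sum_(j < n) (0 : R) ^+ 2 = 0 by apply: big1 => j _; rewrite expr0n.
rewrite mulr0 oppr0 expR0 mulr1.
apply: le_trans; rewrite le_eqVlt; apply/orP; left; apply/eqP.
apply: eq_Rintegral => w _; rewrite [X in cos X]big1 ?cos0 ?mul1r; last first.
  by move=> j _; rewrite mul0r.
by apply: eq_bigl => j; rewrite ltn_ord.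
Qed.

End product_of_cosines.

(** Each index below [n * L] is uniquely [u + L * j], so the average over the grid is the average
    over its [L] lattices. *)
Lemma sum_residue_classes (V : nmodType) (F : nat -> V) (n L : nat) :
  \sum_(l < n * L) F l = \sum_(u < L) \sum_(j < n) F (u + L * j)%N.
Proof.
elim: n => [|n ih].
  by rewrite mul0n big_ord0 big1// => u _; rewrite big_ord0.
rewrite mulSnr big_split_ord /= ih -big_split; apply: eq_bigr => u _ /=.
by rewrite big_ord_recr/= addnC (mulnC L n).
Qed.

(** As [exp(-x) <= 1 / (1 + x)], it suffices that [(2 + cos x)(1 + x) >= 3]: use [cos x >= 1 - x]
    for [x <= 2] and [cos x >= -1] beyond. *)
Lemma expRN_le_cos (R : realType) (x : R) : 0 <= x -> expR (- x) <= (2 + cos x) / 3.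
Proof.
move=> x0.
have x1 : 0 < 1 + x by lra.
have c1 : 1 - x <= cos x.
  have := cos_lipschitz 0 x; rewrite cos0 sub0r normrN (ger0_norm x0).
  by move=> /(le_trans (ler_norm _)); lra.
have c2 := cos_geN1 x.
have h : 3 <= (2 + cos x) * (1 + x) by case: (leP x 2) => x2; nra.
rewrite expRN (@le_trans _ _ (1 + x)^-1)//.
  by rewrite lef_pV2 ?posrE ?expR_gt0// expR_ge1Dx.
by rewrite ler_pdivlMr// mulrC -ler_pdivlMr ?invr_gt0// invrK.
Qed.

Section positivity.
Context (R : realType) d (Omega : measurableType d) (P : probability Omega R).
Variables (Z : nat -> Omega -> R) (n L : nat) (K v tau : R) (A : set Omega).
Hypotheses (n0 : (0 < n)%N) (L0 : (0 < L)%N).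
Hypothesis mZ : forall l, measurable_fun setT (Z l).
Hypothesis mA : measurable A.
Hypothesis AZ : forall w, A w -> forall l, (l < n * L)%N -> 0 < Z l w.
Hypothesis EZ : forall (u : nat) (c : 'I_n -> R), (u < L)%N ->
  \int[P]_w cos (\sum_j c j * Z (u + L * j)%N w) <= expR (- (v * \sum_j c j ^+ 2)).

Let Y w := \sum_(l < n * L) (n * L)%:R^-1 * Z l w.
Let h u w := \prod_(j < n) (2 + cos (Z (u + L * j)%N w)).
Let H w := \sum_(u < L) ((L%:R * 3 ^+ n)^-1 * h u w).

Let mY : measurable_fun setT Y.
Proof. by apply: measurable_sum => l; exact: measurable_funM. Qed.

Let h_ge0 u w : 0 <= h u w.
Proof. by apply: prodr_ge0 => j _; have := cos_geN1 (Z (u + L * j)%N w); lra. Qed.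

Let h_le u w : h u w <= 3 ^+ n.
Proof.
rewrite -[n in leRHS]card_ord -prodr_const; apply: ler_prod => j _.
have := cos_geN1 (Z (u + L * j)%N w); have := cos_le1 (Z (u + L * j)%N w).
by move=> ? ?; apply/andP; split; lra.
Qed.

Let int_h u : P.-integrable setT (EFin \o h u).
Proof.
apply: (@prob_bounded_integrable _ _ _ _ _ (3 ^+ n)).
  apply: measurable_prod => j _; apply: measurable_funD => //.
  exact: measurable_cos_comp.
by move=> w; rewrite ger0_norm.
Qed.

Let int_H : P.-integrable setT (EFin \o H).
Proof. by apply: integrable_sum_EFin => // u; exact: integrableZl_EFin. Qed.

Let H_ge0 w : 0 <= H w.
Proof.
by apply: sumr_ge0 => u _; rewrite mulr_ge0// invr_ge0 mulr_ge0// exprn_ge0.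
Qed.

Let EH : \int[P]_w H w <= ((2 + expR (- v)) / 3) ^+ n.
Proof.
rewrite Rintegral_sum//; last by move=> u; exact: integrableZl_EFin.
apply: (@le_trans _ _ (\sum_(u < L) (L%:R * 3 ^+ n)^-1 * (2 + expR (- v)) ^+ n)).
  apply: ler_sum => u _; rewrite RintegralZl// ler_wpM2l//.
  apply: (@expectation_prod_cos_le _ _ _ P n (fun j => Z (u + L * j)%N) v) => // c.
  exact: EZ.
rewrite sumr_const card_ord -mulr_natr expr_div_n.
rewrite le_eqVlt; apply/orP; left; apply/eqP; field.
by rewrite expf_neq0//= pnatr_eq0 -lt0n.
Qed.

(* Jensen's inequality, through the tangent line of exp at [- n K]. *)
Let H_ge w : A w -> Y w <= K -> expR (- (n%:R * K)) <= H w.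
Proof.
move=> Aw YK.
have LR : 0 < L%:R :> R by rewrite ltr0n.
have nR : 0 < n%:R :> R by rewrite ltr0n.
pose S u := \sum_(j < n) Z (u + L * j)%N w.
have hu (u : 'I_L) : expR (- (n%:R * K)) * (1 + n%:R * K - S u) <= (3 ^+ n)^-1 * h u w.
  apply: (@le_trans _ _ (expR (- S u))).
    have {2}-> : - S u = - (n%:R * K) + (n%:R * K - S u) by ring.
    by rewrite expRD ler_wpM2l ?expR_ge0// -addrA expR_ge1Dx.
  rewrite /h /S -sumrN expR_sum mulrC.
  rewrite -[n in (3 ^+ n)^-1]card_ord -prodr_const -prodf_div.
  apply: ler_prod => j _; rewrite expR_ge0/= expRN_le_cos// ltW//.
  apply: AZ => //; have := ltn_ord u; have := ltn_ord j.
  by move: (nat_of_ord u) (nat_of_ord j) => u' j'; nia.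
have -> : H w = L%:R^-1 * \sum_(u < L) (3 ^+ n)^-1 * h u w.
  by rewrite mulr_sumr; apply: eq_bigr => u _; rewrite invfM mulrA.
rewrite [leRHS]mulrC ler_pdivlMr//.
apply: le_trans (ler_sum _ (fun u _ => hu u)).
rewrite -mulr_sumr ler_wpM2l ?expR_ge0//.
rewrite big_split/= sumr_const card_ord sumrN.
(* Averaged over [u], the tangent factors become [1 + n K - n Y], which is at least 1 when
   [Y <= K]. *)
have SY : \sum_(u < L) S u = n%:R * L%:R * Y w.
  rewrite /S -(sum_residue_classes (fun l => Z l w)) /Y mulr_sumr.
  apply: eq_bigr => l _; rewrite natrM mulrA mulfV ?mul1r//.
  by rewrite mulf_neq0// gt_eqF.
rewrite SY -mulr_natr.
have := ler_wpM2l (ltW (mulr_gt0 nR LR)) YK; lra.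
Qed.

(** Markov's inequality: on the part of [A] where [Y <= K], [H] is at least [exp(- n K)], so this
    part has probability at most [exp(n K)] times the mean of [H]. *)
Lemma positivity_probability_le :
  (P [set w | (K < \sum_(l < n * L) (n * L)%:R^-1 * Z l w)%R] <= tau%:E)%E ->
  (P A <= (tau + expR (n%:R * K) * ((2 + expR (- v)) / 3) ^+ n)%:E)%E.
Proof.
move=> Ptau.
have mK : measurable [set w | (K < Y w)%R] by exact: measurable_gt_set.
pose B := A `\` [set w | (K < Y w)%R].
have mB : measurable B by exact: measurableD.
have AB : A `<=` B `|` [set w | (K < Y w)%R].
  by move=> w Aw; case: (pselect (K < Y w)) => KY; [right|left].
apply: (@le_trans _ _ (P B + P [set w | (K < Y w)%R])%E).
  apply: le_trans (measureU2 _ mB mK).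
  by rewrite le_measure ?inE//; exact: measurableU.
rewrite addeC EFinD leeD//.
have PB : P B \is a fin_num by exact: fin_num_measure.
rewrite -(fineK PB) lee_fin.
have i1 : P.-integrable setT (EFin \o \1_B).
  apply: (@prob_bounded_integrable _ _ _ _ _ 1) => //.
  by move=> x; rewrite indicE; case: (_ \in _); rewrite ?normr1 ?normr0.
have -> : fine (P B) = \int[P]_w \1_B w by rewrite /Rintegral integral_indic// setIT.
apply: (@le_trans _ _ (\int[P]_w (expR (n%:R * K) * H w))).
  apply: le_Rintegral => //; first exact: integrableZl_EFin.
  move=> w _; rewrite indicE; case: (boolP (w \in B)) => [|_]; last first.
    by rewrite mulr_ge0 ?expR_ge0.
  rewrite inE => -[Aw /= /negP]; rewrite -leNgt => YK.
  have := H_ge Aw YK; rewrite -(ler_pM2l (expR_gt0 (n%:R * K))).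
  by rewrite -expRD subrr expR0.
by rewrite RintegralZl// ler_wpM2l ?expR_ge0.
Qed.

End positivity.

(** Continuity from above along the complements of [[-k, k]], which decrease to the empty set;
    monotonicity then covers every larger [x]. *)
Lemma finite_measure_tail (R : realType) (rho : {measure set R -> \bar R}) (eps : R) :
  (rho setT < +oo)%E -> 0 < eps ->
  exists k : nat, (0 < k)%N /\ forall x : R, k%:R <= x -> fine (rho (~` `[- x, x])) <= eps.
Proof.
move=> rfin eps0.
pose F (k : nat) : set R := ~` `[- k%:R, k%:R].
have mF k : measurable (F k) by apply: measurableC; exact: measurable_itv.
have F0 : \bigcap_k F k = set0.
  apply/seteqP; split => // x /= Fx.
  have := Fx (Num.truncn `|x|).+1 I; apply => /=.
  by rewrite in_itv/= -ler_norml ltW// truncnS_gt.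
have rfinS A : measurable A -> (rho A < +oo)%E.
  by move=> mA; apply: le_lt_trans rfin; rewrite le_measure ?inE.
have ndF : {homo F : n m / (n <= m)%N >-> (m <= n)%O}.
  move=> n m nm; rewrite subsetEset; apply: subsetC; apply: subset_itv; rewrite bnd_simp.
    by rewrite lerN2 ler_nat.
  by rewrite ler_nat.
have : (rho \o F) x @[x --> \oo] --> rho (\bigcap_n F n).
  by apply: nonincreasing_cvg_mu => //; [exact: rfinS|rewrite F0].
rewrite F0 measure0 => /fine_cvgP[_] /cvgrPdist_le/(_ _ eps0)[k _ hk].
exists k.+1; split => // x kx.
have := hk k (leqnn k); rewrite /= sub0r normrN => /(le_trans (ler_norm _)).
apply: le_trans; apply: fine_le.
- by rewrite ge0_fin_numE// rfinS//; apply: measurableC; exact: measurable_itv.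
- by rewrite ge0_fin_numE// rfinS.
- rewrite le_measure ?inE//; first by apply: measurableC; exact: measurable_itv.
  have kx' : k%:R <= x by apply: le_trans kx; rewrite ler_nat.
  by apply: subsetC; apply: subset_itv; rewrite bnd_simp ?lerN2.
Qed.

Section gap_probability.
Context (R : realType) (discrete : bool) (rho : {measure set R -> \bar R}) (a m M : R).
Hypotheses (a0 : 0 < a) (m0 : 0 < m) (M0 : 0 < M).
Hypothesis rho_fin : (rho setT < +oo)%E.
Hypothesis rho_itv : forall i : interval R, [set` i] `<=` `]- a, a[ ->
  ((m * itv_length i)%:E <= rho [set` i])%E /\
  (rho [set` i] <= (M * itv_length i)%:E)%E.
Context d (Omega : measurableType d) (P : probability Omega R) (f : R -> Omega -> R).
Hypothesis gp : gaussian_process_with_covariance discrete P f (covariance_of rho).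

Let rho_ge (i : interval R) : [set` i] `<=` `]- a, a[ ->
  ((m * itv_length i)%:E <= rho [set` i])%E.
Proof. by move=> /rho_itv[]. Qed.

Let rho_le (i : interval R) : [set` i] `<=` `]- a, a[ ->
  (rho [set` i] <= (M * itv_length i)%:E)%E.
Proof. by move=> /rho_itv[]. Qed.

Let mf t : time_set discrete t -> measurable_fun setT (f t).
Proof.
move=> tT; have [h _] := gp.
have [+ _] := h 1%N (fun=> t) (fun=> 1) (fun=> tT).
by under eq_fun do rewrite big_ord1 mul1r.
Qed.

Lemma gaussian_linear_combination n (t c : 'I_n -> R) :
  (forall i, time_set discrete (t i)) ->
  let X := fun w => \sum_(i < n) c i * f (t i) w in
  measurable_fun setT X /\
  forall B : set R, measurable B -> P (X @^-1` B) =
    centered_gaussian_law (\int[rho]_l spectral_form t c l) B.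
Proof.
move=> tT X; have [h _] := gp; have [mX lX] := h n t c tT.
rewrite -(variance_spectral t c rho_fin).
exact: (conj mX lX).
Qed.

(** The grid has mesh [eta = 1 / k] and splits into [L = s * k] lattices of spacing [s], spanning a
    time [n * s <= N]; in discrete time [k = 1] keeps it inside the integers. The bound does not
    involve [k], so the mesh can be chosen last. *)
Lemma gap_probability_le (s k n : nat) (N K : R) :
  (0 < s)%N -> (0 < k)%N -> (0 < n)%N -> (discrete -> k = 1%N) ->
  8 < s%:R * a -> n%:R * s%:R <= N -> 0 <= K ->
  4 * fine (rho setT) + 1 <= M * a * n%:R ->
  fine (rho (~` `[- (pi / k%:R^-1), pi / k%:R^-1])) <= (n.+1%:R ^+ 2)^-1 ->
  (P (gap_event discrete f N) <=
   (Num.sqrt 2 * expR (- (K ^+ 2 / (68 * M * a) * n%:R)) +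
    expR (n%:R * K) * ((2 + expR (- (m * pi / s%:R))) / 3) ^+ n)%:E)%E.
Proof.
move=> s0 k0 n0 dk sa nN K0 nbig tailk.
have sR : 0 < s%:R :> R by rewrite ltr0n.
have kR : 0 < k%:R :> R by rewrite ltr0n.
have nR : 0 < n%:R :> R by rewrite ltr0n.
set eta : R := k%:R^-1.
have eta0 : 0 < eta by rewrite invr_gt0.
have etak : eta * k%:R = 1 by rewrite mulVf// gt_eqF.
have tset (l : nat) : time_set discrete (eta * l%:R).
  rewrite /time_set; case: (boolP discrete) => // dd.
  by exists (Posz l); rewrite /eta (dk dd) invr1 mul1r.
have psa : pi / s%:R < a.
  rewrite ltr_pdivrMr// mulrC; apply: le_lt_trans sa.
  by have [/andP[_]] := pihalf_02_cos_pihalf R; lra.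
apply: (@positivity_probability_le _ _ _ P (fun l => f (eta * l%:R)) n (s * k)) => //.
- by rewrite muln_gt0 s0.
- by move=> l; exact: mf.
- by apply: measurable_gap_event => [t /mf //|]; have [] := gp.
- move=> w gw l lnL; apply: gw => //; first by rewrite mulr_ge0// ltW.
  apply: lt_le_trans nN.
  have -> : n%:R * s%:R = eta * (n * (s * k))%:R.
    by rewrite !natrM -[LHS]mulr1 -[X in _ * X]etak; ring.
  by rewrite ltr_pM2l// ltr_nat.
(* As [eta * k = 1], the lattice through [eta * u] has spacing [s]. Its covariance bound
   [2 pi m / s], halved in the characteristic function, gives [v = m pi / s]. *)
- move=> u c uL.
  have [mX lX] := gaussian_linear_combination c (fun j : 'I_n => tset (u + s * k * j)%N).
  rewrite (expectation_cos_gaussian _ mX lX); last first.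
    by apply: Rintegral_ge0 => l _; exact: spectral_form_ge0.
  have -> : (fun j : 'I_n => eta * (u + s * k * j)%:R) =
            (fun j : 'I_n => eta * u%:R + s%:R * j%:R).
    apply/funext => j; rewrite natrD mulrDr; congr (_ + _).
    transitivity (eta * k%:R * (s%:R * j%:R)); first by rewrite !natrM; ring.
    by rewrite etak mul1r.
  have := variance_lower_bound rho_fin (ltW m0) rho_ge (eta * u%:R) c sR psa.
  rewrite ler_expR lerN2; set V := \int[rho]_l _; set S := \sum_j _ => hV.
  apply: (@le_trans _ _ (m * (pi *+ 2 / s%:R) * S / 2)); last by rewrite ler_pM2r.
  by rewrite le_eqVlt; apply/orP; left; apply/eqP; field; rewrite gt_eqF.
- have [_ lX] := gaussian_linear_combination
    (fun=> (n * (s * k))%:R^-1) (fun l : 'I_(n * (s * k)) => tset l).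
  (* The layers give [16 M a / n], and [nbig] with [tailk] make the two tail terms together at most
     [M a / n]; then [4 V = 68 M a / n]. *)
  pose V := 17 * M * a / n%:R.
  have V0 : 0 < V by rewrite divr_gt0// !mulr_gt0.
  have -> : K ^+ 2 / (68 * M * a) * n%:R = K ^+ 2 / (4 * V).
    by rewrite /V; field; rewrite !gt_eqF.
  have var0 : 0 <= \int[rho]_l spectral_form
      (fun l : 'I_(n * (s * k)) => eta * l%:R) (fun=> (n * (s * k))%:R^-1) l.
    by apply: Rintegral_ge0 => l _; exact: spectral_form_ge0.
  apply: (gaussian_tail var0 lX _ V0 K0).
  have W : 8 * n%:R <= (n * (s * k))%:R * eta * a.
    rewrite !natrM.
    have -> : n%:R * (s%:R * k%:R) * eta * a = n%:R * (s%:R * a) * (eta * k%:R) by ring.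
    by rewrite etak mulr1 mulrC ler_pM2l// ltW.
  have nL0 : (0 < n * (s * k))%N by rewrite !muln_gt0 n0 s0.
  apply: le_trans (variance_mean_le rho_fin a0 (ltW M0) rho_le n0 nL0 eta0 W) _.
  apply: (le_trans (lerD (lexx _) tailk)).
  set T := fine _ in nbig *.
  have n1 : 0 < n.+1%:R :> R by rewrite ltr0n.
  have h : (4 * T + 1) / n.+1%:R ^+ 2 <= M * a / n%:R.
    rewrite ler_pdivrMr ?exprn_gt0// (le_trans nbig)//.
    rewrite [leRHS]mulrAC ler_pdivlMr// -[leLHS]mulrA ler_pM2l ?mulr_gt0//.
    by rewrite -expr2 lerXn2r ?nnegrE// ler_nat.
  have -> : V = 16 * M * a / n%:R + M * a / n%:R by rewrite /V; field; rewrite gt_eqF.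
  rewrite -addrA lerD2l; apply: le_trans h.
  by rewrite le_eqVlt; apply/orP; left; apply/eqP; field; rewrite gt_eqF.
Qed.

End gap_probability.

Theorem mainTheorem1 (R : realType) (discrete : bool) (a m M : R) :
  0 < a -> 0 < m -> 0 < M ->
  exists C : R, 0 < C /\
  forall (rho : {measure set R -> \bar R}),
    spectral_measure discrete rho ->
    (exists delta : R, 0 < delta /\
       (\int[rho]_(l in setT) ((`|l| `^ delta)%:E) < +oo)%E) ->
    (forall i : interval R, [set` i] `<=` `]- a, a[ ->
       ((m * itv_length i)%:E <= rho [set` i])%E /\
       (rho [set` i] <= (M * itv_length i)%:E)%E) ->
    forall (d : measure_display) (Omega : measurableType d)
           (P : probability Omega R) (f : R -> Omega -> R),
    gaussian_process_with_covariance discrete P f (covariance_of rho) ->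
    exists N0 : R, forall N : R, N0 <= N ->
      (P (gap_event discrete f N) <= (expR (- (C * N)))%:E)%E.
Proof.
move=> a0 m0 M0.
(* Everything down to the witness for [C] depends on [a], [m] and [M] only; [rho] is introduced
   afterwards and affects the threshold on [N] and the grid. *)
pose s := (Num.truncn (8 / a)).+1.
have s0 : (0 < s)%N by [].
have sR : 0 < s%:R :> R by rewrite ltr0n.
have sa : 8 < s%:R * a by rewrite -ltr_pdivrMr// truncnS_gt.
pose r : R := (2 + expR (- (m * pi / s%:R))) / 3.
have v0 : 0 < m * pi / s%:R by rewrite divr_gt0// mulr_gt0// pi_gt0.
have r0 : 0 < r by rewrite divr_gt0// addr_gt0// expR_gt0.
have r1 : r < 1.
  by rewrite /r ltr_pdivrMr// mul1r (_ : 3 = 2 + 1) ?ltrD2l ?expR_lt1 ?oppr_lt0//; ring.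
(* Half of the rate of [r^n] is kept: [exp(n K) r^n = exp(- n K)]. *)
pose K : R := - ln r / 2.
have K0 : 0 < K by rewrite divr_gt0// oppr_gt0 ln_lt0// r0.
pose c1 := K ^+ 2 / (68 * M * a).
have c10 : 0 < c1 by rewrite divr_gt0 ?exprn_gt0// !mulr_gt0.
pose c0 := Num.min K c1.
have c00 : 0 < c0 by rewrite lt_min K0.
(* From [n >= N / (2 s)] the exponent is at least [c0 N / (2 s)]; half of it absorbs the constant
   factor [exp 2]. *)
exists (c0 / (4 * s%:R)); split; first by rewrite divr_gt0// mulr_gt0.
move=> rho [rho_fin [_ rho_pi]] _ rho_itv d Omega P f gp.
pose T := fine (rho setT).
pose n1 := (Num.truncn ((4 * T + 1) / (M * a))).+1.
(* The first bound gives [N / s >= 2 n1 >= 2], so that rounding down leaves [n >= N / (2 s)] and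
   [n >= n1]; the second gives [c0 N / (4 s) >= 2]. *)
exists (Num.max (2 * s%:R * n1%:R) (8 * s%:R / c0)) => N.
rewrite ge_max => /andP[Nn1 Nc0].
pose n := Num.truncn (N / s%:R).
have N0 : 0 <= N by apply: le_trans Nn1; rewrite !mulr_ge0.
have nle : n%:R <= N / s%:R by rewrite truncn_le// divr_ge0.
have ngt : N / s%:R < n%:R + 1 by rewrite natr1 truncnS_gt.
have n1R : 1 <= n1%:R :> R by rewrite ler1n.
have Ns : 2 * n1%:R <= N / s%:R by rewrite ler_pdivlMr// mulrAC.
have nN2 : N / s%:R / 2 <= n%:R by lra.
have nn1 : n1%:R <= n%:R :> R by lra.
have n0 : (0 < n)%N by rewrite -(ltr_nat R) (lt_le_trans _ nn1)// (lt_le_trans ltr01).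
have nN : n%:R * s%:R <= N by rewrite -ler_pdivlMr.
have nbig : 4 * T + 1 <= M * a * n%:R.
  rewrite [leRHS]mulrC -ler_pdivrMr ?mulr_gt0// (le_trans _ nn1)// ltW// truncnS_gt//.
(* In discrete time [rho] has no mass outside [[-pi, pi]], so [k = 1] works; in continuous time the
   mesh is refined once [n] is known, so [k] varies with [N]. *)
have [k [k0 [kd kt]]] : exists k : nat, (0 < k)%N /\ (discrete -> k = 1%N) /\
    fine (rho (~` `[- (pi / k%:R^-1), pi / k%:R^-1])) <= (n.+1%:R ^+ 2)^-1.
  have eps0 : 0 < (n.+1%:R ^+ 2)^-1 :> R by rewrite invr_gt0 exprn_gt0// ltr0n.
  case: (boolP discrete) => [dd|nd].
    by exists 1%N; split=> //; split=> //; rewrite invr1 divr1 rho_pi// ltW.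
  have [k [k0 hk]] := finite_measure_tail rho_fin eps0.
  exists k; split=> //; split=> //; apply: hk; rewrite invrK.
  by rewrite ler_peMl// (le_trans _ (pi_ge2 R))// ler1n.
apply: le_trans (gap_probability_le a0 m0 M0 rho_fin rho_itv gp s0 k0 n0 kd sa nN
  (ltW K0) nbig kt) _.
rewrite lee_fin -/r -/c1.
have -> : expR (n%:R * K) * r ^+ n = expR (- (K * n%:R)).
  rewrite -[r in LHS]lnK ?posrE// -expRM_natl -expRD -mulr_natl; congr expR.
  by rewrite /K; field.
have cK : c0 <= K by rewrite ge_min lexx.
have cc1 : c0 <= c1 by rewrite ge_min lexx orbT.
have n00 : 0 <= n%:R :> R by [].
have e1 : expR (- (c1 * n%:R)) <= expR (- (c0 * n%:R)).
  by rewrite ler_expR lerN2 ler_wpM2r.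
have e2 : expR (- (K * n%:R)) <= expR (- (c0 * n%:R)).
  by rewrite ler_expR lerN2 ler_wpM2r.
(* Both terms decay at rate at least [c0], and their constants add up to
   [sqrt 2 + 1 <= 3 <= exp 2]. *)
have s2 : Num.sqrt 2 <= 2 :> R.
  by rewrite -[leRHS](@ger0_norm _ 2)// -sqrtr_sqr ler_wsqrtr// expr2; lra.
have e3 : 3 <= expR 2 :> R by apply: le_trans (expR_ge1Dx _); lra.
apply: (@le_trans _ _ (expR 2 * expR (- (c0 * n%:R)))).
  apply: (@le_trans _ _ (3 * expR (- (c0 * n%:R)))); last by rewrite ler_wpM2r ?expR_ge0.
  rewrite (_ : 3 = 2 + 1); last by ring.
  by rewrite mulrDl mul1r lerD// ler_pM ?sqrtr_ge0 ?expR_ge0.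
rewrite -expRD ler_expR.
have h1 : c0 * (N / s%:R / 2) <= c0 * n%:R by rewrite ler_wpM2l// ltW.
have h2 : 8 <= c0 * (N / s%:R).
  by move: Nc0; rewrite ler_pdivrMr// mulrA ler_pdivlMr// (mulrC c0).
have -> : c0 / (4 * s%:R) * N = c0 * (N / s%:R) / 4 by field; rewrite gt_eqF.
lra.
Qed.
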